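(* For every $\varepsilon>0$ there exists a positive integer $q$ such that for every $k$ and every $2\le r\le k-q$, every $k$-uniform hypergraph with $m$ edges has an $r$-cut of surplus $\Omega(m^{2/3-\varepsilon})$ (the implicit constant depending on $k$ and $\varepsilon$).
   Context: An $r$-cut of a $k$-uniform hypergraph is a partition of its vertex set into $r$ parts; its size is the number of edges with at least one vertex in each part. The surplus of an $r$-cut in a $k$-uniform hypergraph with $m$ edges is its size minus $\frac{S(k,r)\,r!}{r^k}m$, with $S(k,r)$ the Stirling number of the second kind. *)

(* Defs.v *)
From HB Require Import structures.
From mathcomp Require Import all_boot all_order all_algebra.
From mathcomp Require Import reals exp.

Set Implicit Arguments.
Unset Strict Implicit.
Unset Printing Implicit Defensive.

Import Order.TTheory GRing.Theory Num.Theory.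

Local Open Scope ring_scope.

(* A (simple) hypergraph on the finite vertex set V is its edge set
   E : {set {set V}}; the number m of edges is #|E|. *)
Definition uniform (V : finType) (k : nat) (E : {set {set V}}) : Prop :=
  {in E, forall e : {set V}, #|e| = k}.

(* The parts of a [partition] are nonempty. *)
Definition is_cut (V : finType) (r : nat) (P : {set {set V}}) : bool :=
  partition P [set: V] && (#|P| == r).

Definition cut_size (V : finType) (E P : {set {set V}}) : nat :=
  #|[set e in E | [forall A in P, e :&: A != set0]]|.

Definition stirling2 (k r : nat) : nat :=
  #|[set P : {set {set 'I_k}} | partition P [set: 'I_k] & #|P| == r]|.

Definition surplus (R : realType) (V : finType) (k r : nat)
    (E P : {set {set V}}) : R :=
  (cut_size E P)%:R - (stirling2 k r * r`!)%:R / r%:R ^+ k * #|E|%:R.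

(* Main.v *)
Require Import Defs.
From HB Require Import structures.
From mathcomp Require Import all_boot all_order all_algebra.
From mathcomp Require Import reals exp.
From mathcomp Require Import perm zify ring lra.

(* Perturb the uniform random colouring at each vertex v by a bias z_v in
   [-1, 1] between two fixed colours.  The expected surplus is then -G(z), where
   G is a multilinear polynomial: a sum over edges e and nonempty even S <= e of
   b(e, S) * prod_(v in S) z_v with b >= 0, and b is bounded below as long as
   |S| <= k - r + 2.  It remains to find a point z where G is very negative.

   (1) For an involution tau, put z_(tau v) = - z_v with random signs.  This gains
   a constant times the number of pairs {v, tau v} inside edges.  Splitting complete
   graphs into matchings, either this gains m^(2/3), or there is an ordering of the
   vertices in which every vertex has at most m^(2/3) codegree with its predecessors.

   (2) Write mu = m^(1/Q).  In each edge, along sizes l_p growing geometrically,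
   the maximal degree of an l_p-subset drops by at most a factor mu at some p < Q.
   Hence there are sets T of a common size s = J l, pairwise meeting in fewer than
   l vertices, whose degrees add up to m / (const * mu).

   (3) Let y be random signs, and let
   x_v = theta * sum of prod_(u in S - v) y_u over the S in T whose last vertex is v.
   At z = (y - x) / 2 the terms of G of degree one in x gain theta times the mass
   of T.  A term of degree j with 2 <= j <= J survives only if each set S involved
   meets the edge in at least l vertices, and there are at most 2^k such S, so these
   terms cost O(m theta^2).  Larger j, and the truncation of x to [-1, 1], are
   negligible by hypercontractivity.  As |T_v| = O(m^(2/3)), theta can be taken
   almost as large as m^(-1/3). *)

Set Implicit Arguments.
Unset Strict Implicit.
Unset Printing Implicit Defensive.

Import Order.TTheory GRing.Theory Num.Theory.

Local Open Scope ring_scope.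

(** * Expectation over random signs *)

Section Cube.
Variables (R : realFieldType) (V : finType).
Implicit Types (A S T Y : {set V}) (v x : V) (f g : {set V} -> R).

(** A sign vector in {-1, 1}^V is encoded by the set Y of its negative coordinates. Thus [Ex]
    averages over finitely many subsets and [chi] is a Walsh character. *)
Definition sgn Y v : R := (-1) ^+ (v \in Y).
Definition chi A Y : R := \prod_(v in A) sgn Y v.
Definition flip x Y : {set V} := if x \in Y then Y :\ x else x |: Y.
Definition Ex f : R := (\sum_Y f Y) / #|{: {set V}}|%:R.

Lemma in_flip x Y v : (v \in flip x Y) = (v \in Y) (+) (v == x).
Proof.
rewrite /flip; case: ifP => xY; rewrite !inE.
  by case: eqVneq => [->|] /=; rewrite ?xY ?addbF ?addbT.
by case: eqVneq => [->|] /=; rewrite ?xY ?addbF ?addbT.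
Qed.

Lemma flipK x : involutive (flip x).
Proof. by move=> Y; apply/setP => v; rewrite !in_flip addbK. Qed.

Lemma sgn_flip x Y v : sgn (flip x Y) v = if v == x then - sgn Y v else sgn Y v.
Proof.
rewrite /sgn in_flip; case: eqP => _; last by rewrite addbF.
by rewrite addbT; case: (_ \in _); rewrite /= ?expr0 ?expr1 ?opprK.
Qed.

Lemma sgnM Y v : sgn Y v * sgn Y v = 1.
Proof. by rewrite /sgn -expr2 sqrr_sign. Qed.

Lemma normr_sgn Y v : `|sgn Y v| = 1.
Proof. by rewrite /sgn normrX normrN1 expr1n. Qed.

Lemma normr_chi A Y : `|chi A Y| = 1.
Proof. by rewrite /chi normr_prod big1 // => v _; rewrite normr_sgn. Qed.

Lemma chiM A Y : chi A Y * chi A Y = 1.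
Proof. by rewrite /chi -big_split big1 //= => v _; rewrite sgnM. Qed.

Lemma chi_flip A x Y : chi A (flip x Y) = if x \in A then - chi A Y else chi A Y.
Proof.
rewrite /chi; case: ifP => xA.
  rewrite (bigD1 x) //= sgn_flip eqxx mulNr (bigD1 x xA) /=; congr (- (_ * _)).
  by apply: eq_bigr => v /andP[_ /negPf vx]; rewrite sgn_flip vx.
by apply: eq_bigr => v vA; rewrite sgn_flip; case: eqP => // vx; rewrite -vx vA in xA.
Qed.

Lemma card_setT_gt0 : (0 : R) < #|{: {set V}}|%:R.
Proof. by rewrite ltr0n; apply/card_gt0P; exists set0. Qed.

Lemma eq_Ex f g : f =1 g -> Ex f = Ex g.
Proof. by move=> fg; rewrite /Ex (eq_bigr g). Qed.

Lemma Ex_le f g : (forall Y, f Y <= g Y) -> Ex f <= Ex g.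
Proof.
by move=> fg; rewrite /Ex ler_pM2r ?invr_gt0 ?card_setT_gt0 //; apply: ler_sum.
Qed.

Lemma ExD f g : Ex (fun Y => f Y + g Y) = Ex f + Ex g.
Proof. by rewrite /Ex big_split mulrDl. Qed.

Lemma ExZ c f : Ex (fun Y => c * f Y) = c * Ex f.
Proof. by rewrite /Ex -mulr_sumr mulrA. Qed.

Lemma ExN f : Ex (fun Y => - f Y) = - Ex f.
Proof. by rewrite /Ex sumrN mulNr. Qed.

Lemma ExB f g : Ex (fun Y => f Y - g Y) = Ex f - Ex g.
Proof. by rewrite -ExN -ExD. Qed.

Lemma Ex_const c : Ex (fun=> c) = c.
Proof.
by rewrite /Ex sumr_const -[c *+ _]mulr_natr mulfK // gt_eqF // card_setT_gt0.
Qed.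

Lemma Ex_sum (I : Type) (r : seq I) (P : pred I) (F : I -> {set V} -> R) :
  Ex (fun Y => \sum_(i <- r | P i) F i Y) = \sum_(i <- r | P i) Ex (F i).
Proof. by rewrite /Ex exchange_big /= mulr_suml. Qed.

Lemma Ex_ge0 f : (forall Y, 0 <= f Y) -> 0 <= Ex f.
Proof. by move=> f0; rewrite -(Ex_const 0); apply: Ex_le. Qed.

Lemma Ex_norm f : `|Ex f| <= Ex (fun Y => `|f Y|).
Proof.
rewrite /Ex normrM normfV (gtr0_norm card_setT_gt0).
by rewrite ler_pM2r ?invr_gt0 ?card_setT_gt0 // ler_norm_sum.
Qed.

Lemma Ex_exists f c : Ex f <= c -> exists Y, f Y <= c.
Proof.
move=> fc; apply/existsP; apply: contraTT fc => /existsPn nf.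
rewrite -ltNge -(Ex_const c) /Ex ltr_pM2r ?invr_gt0 ?card_setT_gt0 //.
apply: ltr_sum; first by apply/hasP; exists set0; rewrite // mem_index_enum.
by move=> Y _; rewrite ltNge nf.
Qed.

Lemma Ex_flip x f : Ex (fun Y => f (flip x Y)) = Ex f.
Proof. by rewrite /Ex; congr (_ / _); rewrite [RHS](reindex_inj (inv_inj (flipK x))). Qed.

Lemma Ex_odd x f : (forall Y, f (flip x Y) = - f Y) -> Ex f = 0.
Proof.
move=> fx; have := Ex_flip x f; rewrite (eq_Ex fx) ExN => h; lra.
Qed.

(** The quadratic form [Ex (s f - t g) ^ 2] is nonnegative; it is evaluated at a point (s, t) that
    yields the discriminant bound. *)
Lemma Ex_CS f g : Ex (fun Y => f Y * g Y) ^+ 2 <= Ex (fun Y => f Y ^+ 2) * Ex (fun Y => g Y ^+ 2).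
Proof.
set a := Ex (fun Y => f Y ^+ 2); set b := Ex _; set c := Ex (fun Y => g Y ^+ 2).
have a0 : 0 <= a by apply: Ex_ge0 => Y; apply: sqr_ge0.
have c0 : 0 <= c by apply: Ex_ge0 => Y; apply: sqr_ge0.
have q s t : 0 <= s ^+ 2 * a + t ^+ 2 * c - 2 * s * t * b.
  rewrite -!ExZ -ExD -ExB; apply: Ex_ge0 => Y.
  by rewrite (_ : _ - _ = (s * f Y - t * g Y) ^+ 2) ?sqr_ge0 //; ring.
have [c1|/negPf c1] := eqVneq c 0.
  (* With c = 0 this point gives - b ^ 2 (a + 2) >= 0, hence b = 0. *)
  have := q b (a + 1); rewrite c1 mulr0 addr0 => h.
  have -> : a * 0 = 0 by rewrite mulr0.
  suff : b ^+ 2 * (a + 2) <= 0 by move=> h2; have := sqr_ge0 b; nra.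
  nra.
have cp : 0 < c by rewrite lt_def c1 c0.
have := q c b => h.
have e : c ^+ 2 * a + b ^+ 2 * c - 2 * c * b * b = c * (c * a - b ^+ 2) by ring.
by move: h; rewrite e pmulr_rge0 // subr_ge0 mulrC.
Qed.

End Cube.

(** * Hypercontractivity *)

Section Bonami.
Variables (R : realFieldType) (V : finType).
Implicit Types (Y : {set V}) (s : seq V) (f g : {set V} -> R).

(* Multilinear polynomials of degree at most d in the signs of the vertices of s. *)
Fixpoint deg_le s (d : nat) g : Prop :=
  match s with
  | [::] => exists c, forall Y, g Y = c
  | v :: s' => exists a b, [/\ deg_le s' d a, deg_le s' d.-1 b,
      d = 0%N -> forall Y, b Y = 0 & forall Y, g Y = a Y + sgn R Y v * b Y]
  end.

Lemma deg_le_ext s d f g : f =1 g -> deg_le s d f -> deg_le s d g.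
Proof.
case: s => [|v s] /= fg; first by case=> c fc; exists c => Y; rewrite -fg.
by case=> a [b [ha hb h0 e]]; exists a, b; split=> // Y; rewrite -fg.
Qed.

Lemma deg_le_mono s d d' g : (d <= d')%N -> deg_le s d g -> deg_le s d' g.
Proof.
elim: s d d' g => [//|v s IH] d d' g dd' /= [a [b [ha hb h0 e]]].
exists a, b; split=> //; first exact: IH ha.
  by apply: IH hb; lia.
by move=> d0; apply: h0; lia.
Qed.

Lemma deg_le_const s d c : deg_le s d (fun=> c).
Proof.
elim: s d c => [|v s IH] d c /=; first by exists c.
by exists (fun=> c), (fun=> 0); split=> // Y; rewrite mulr0 addr0.
Qed.

Lemma deg_leD s d f g : deg_le s d f -> deg_le s d g -> deg_le s d (fun Y => f Y + g Y).
Proof.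
elim: s d f g => [|v s IH] d f g /=.
  by case=> c fc [c' gc]; exists (c + c') => Y; rewrite fc gc.
case=> a [b [ha hb h0 e]] [a' [b' [ha' hb' h0' e']]].
exists (fun Y => a Y + a' Y), (fun Y => b Y + b' Y); split; rewrite ?e ?e'.
- exact: IH.
- exact: IH.
- by move=> d0 Y; rewrite h0 // h0' // addr0.
- by move=> Y; rewrite e e'; ring.
Qed.

Lemma deg_le_sum (I : Type) (r : seq I) (P : pred I) (F : I -> {set V} -> R) s d :
  (forall i, P i -> deg_le s d (F i)) ->
  deg_le s d (fun Y => \sum_(i <- r | P i) F i Y).
Proof.
move=> h; elim: r => [|i r IH].
  by apply: (deg_le_ext _ (deg_le_const s d 0)) => Y; rewrite big_nil.
have [Pi|/negPf Pi] := boolP (P i); last first.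
  by apply: deg_le_ext IH => Y; rewrite big_cons Pi.
apply: (@deg_le_ext _ _ (fun Y => F i Y + \sum_(j <- r | P j) F j Y)).
  by move=> Y; rewrite big_cons Pi.
exact: deg_leD (h i Pi) IH.
Qed.

Lemma deg_leM s d d' f g :
  deg_le s d f -> deg_le s d' g -> deg_le s (d + d') (fun Y => f Y * g Y).
Proof.
elim: s d d' f g => [|v s IH] d d' f g /=.
  by case=> c fc [c' gc]; exists (c * c') => Y; rewrite fc gc.
case=> a [b [ha hb h0 e]] [a' [b' [ha' hb' h0' e']]].
exists (fun Y => a Y * a' Y + b Y * b' Y), (fun Y => a Y * b' Y + b Y * a' Y).
split.
- apply: deg_leD; first exact: IH.
  by apply: deg_le_mono (IH _ _ _ _ hb hb'); lia.
- apply: deg_leD.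
    have [d'0|d'0] := posnP d'.
      apply: (deg_le_ext _ (deg_le_const s _ 0)) => Y; rewrite h0' ?mulr0 //.
    by apply: deg_le_mono (IH _ _ _ _ ha hb'); lia.
  have [d0|d0] := posnP d.
    apply: (deg_le_ext _ (deg_le_const s _ 0)) => Y; rewrite h0 ?mul0r //.
  by apply: deg_le_mono (IH _ _ _ _ hb ha'); lia.
- by move=> dd Y; rewrite h0 ?h0' ?mulr0 ?mul0r ?addr0 //; lia.
- move=> Y; rewrite e e'; have := sgnM R Y v; move: (sgn R Y v) => t tt.
  transitivity (a Y * a' Y + (t * t) * (b Y * b' Y) + t * (a Y * b' Y + b Y * a' Y)).
    by ring.
  by rewrite tt mul1r.
Qed.

Lemma deg_leX s d f n : deg_le s d f -> deg_le s (d * n) (fun Y => f Y ^+ n).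
Proof.
move=> h; elim: n => [|n IH].
  by apply: (deg_le_ext _ (deg_le_const s _ 1)) => Y; rewrite expr0.
apply: (@deg_le_ext _ _ (fun Y => f Y * f Y ^+ n)); first by move=> Y; rewrite exprS.
by rewrite mulnS; apply: deg_leM.
Qed.

Lemma deg_le_prod (T : {set V}) s :
  deg_le s (count (mem T) s) (fun Y => \prod_(v <- s | v \in T) sgn R Y v).
Proof.
elim: s => [|v s IH] /=; first by exists 1 => Y; rewrite big_nil.
have [vT|/negPf vT] := boolP (v \in T).
  exists (fun=> 0), (fun Y => \prod_(v <- s | v \in T) sgn R Y v).
  split=> // [|Y]; first exact: deg_le_const.
  by rewrite big_cons vT add0r.
exists (fun Y => \prod_(v <- s | v \in T) sgn R Y v), (fun=> 0).
split=> // [|Y]; first exact: deg_le_const.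
by rewrite big_cons vT mulr0 addr0.
Qed.

Lemma deg_le_chi (T : {set V}) d : (#|T| <= d)%N -> deg_le (enum V) d (chi R T).
Proof.
move=> hT; apply: deg_le_mono (_ : (count (mem T) (enum V) <= d)%N) _.
  rewrite -size_filter; apply: leq_trans hT.
  by rewrite cardE {2}/enum_mem -enumT.
apply: deg_le_ext (deg_le_prod T (enum V)) => Y.
by rewrite /chi big_enum_cond.
Qed.

Lemma deg_le_flip s d g x Y : x \notin s -> deg_le s d g -> g (flip x Y) = g Y.
Proof.
elim: s d g => [|v s IH] d g /=; first by move=> _ [c gc]; rewrite !gc.
rewrite inE negb_or => /andP[xv xs] [a [b [ha hb _ e]]].
rewrite !e (IH _ _ xs ha) (IH _ _ xs hb) sgn_flip.
by rewrite eq_sym (negPf xv).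
Qed.

(** Induction on the number of variables. In g = a + t b the parts a and b do not depend on the sign
    t, so only even powers of t survive in the fourth moment. Cauchy-Schwarz bounds the mixed moment
    of a ^ 2 and b ^ 2, and the factor 9 saved by the smaller degree of b pays for its coefficient
    6. *)
Lemma bonami s d g : uniq s -> deg_le s d g ->
  Ex (fun Y => g Y ^+ 4) <= 9 ^+ d * Ex (fun Y => g Y ^+ 2) ^+ 2.
Proof.
elim: s d g => [|v s IH] d g /=.
  move=> _ [c gc]; rewrite (eq_Ex (g := fun=> c ^+ 4)); last by move=> Y; rewrite gc.
  rewrite (eq_Ex (f := fun Y => g Y ^+ 2) (g := fun=> c ^+ 2)); last by move=> Y; rewrite gc.
  rewrite !Ex_const -exprM ler_peMl ?exprn_even_ge0 //.
  by rewrite exprn_ege1 // ler1n.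
case/andP=> vs us [a [b [ha hb h0 e]]].
(* In degree 0 the predecessor does not lower the degree; there the clause of [deg_le] for d = 0
   gives b = 0. *)
case: d ha hb h0 e => [|d] ha hb h0 e.
  have ga Y : g Y = a Y by rewrite e h0 // mulr0 addr0.
  have := IH _ _ us ha.
  rewrite (eq_Ex (g := fun Y => g Y ^+ 4)); last by move=> Y; rewrite ga.
  by rewrite (eq_Ex (f := fun Y => a Y ^+ 2) (g := fun Y => g Y ^+ 2)) // => Y; rewrite ga.
have fa Y := deg_le_flip Y vs ha.
have fb Y := deg_le_flip Y vs hb.
have {}IHa := IH _ _ us ha; have {}IHb := IH _ _ us hb; rewrite /= in IHb.
have tt Y := sgnM R Y v.
have fs Y : sgn R (flip v Y) v = - sgn R Y v by rewrite sgn_flip eqxx.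
have t2 Y : sgn R Y v ^+ 2 = 1 by rewrite expr2 tt.
have -> : Ex (fun Y => g Y ^+ 2) = Ex (fun Y => a Y ^+ 2) + Ex (fun Y => b Y ^+ 2).
  rewrite -[RHS]addr0 -(@Ex_odd R V v (fun Y => 2 * sgn R Y v * a Y * b Y)).
    rewrite -!ExD; apply: eq_Ex => Y; rewrite e.
    transitivity (a Y ^+ 2 + sgn R Y v ^+ 2 * b Y ^+ 2 + 2 * sgn R Y v * a Y * b Y).
      by ring.
    by rewrite t2 mul1r.
  by move=> Y; rewrite fa fb fs; ring.
have -> : Ex (fun Y => g Y ^+ 4) = Ex (fun Y => a Y ^+ 4) + Ex (fun Y => b Y ^+ 4)
    + 6 * Ex (fun Y => a Y ^+ 2 * b Y ^+ 2).
  rewrite -[RHS]addr0 -(@Ex_odd R V v (fun Y => 4 * sgn R Y v * a Y * b Y * (a Y ^+ 2 + b Y ^+ 2))).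
    rewrite -ExZ -!ExD; apply: eq_Ex => Y; rewrite e.
    move: (t2 Y) (tt Y); move: (sgn R Y v) => t t2' tt'.
    transitivity (a Y ^+ 4 + (t ^+ 2) ^+ 2 * b Y ^+ 4 + 6 * (t ^+ 2 * (a Y ^+ 2 * b Y ^+ 2))
       + 4 * t * a Y * b Y * (a Y ^+ 2 + t ^+ 2 * b Y ^+ 2)); first by ring.
    by rewrite t2' expr1n !mul1r.
  by move=> Y; rewrite fa fb fs; ring.
have := Ex_CS (fun Y => a Y ^+ 2) (fun Y => b Y ^+ 2).
rewrite (eq_Ex (f := fun Y => (a Y ^+ 2) ^+ 2) (g := fun Y => a Y ^+ 4)); last by move=> Y; rewrite -exprM.
rewrite (eq_Ex (f := fun Y => (b Y ^+ 2) ^+ 2) (g := fun Y => b Y ^+ 4)); last by move=> Y; rewrite -exprM.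
have A0 : 0 <= Ex (fun Y => a Y ^+ 2) by apply: Ex_ge0 => Y; apply: sqr_ge0.
have B0 : 0 <= Ex (fun Y => b Y ^+ 2) by apply: Ex_ge0 => Y; apply: sqr_ge0.
have C0 : 0 <= Ex (fun Y => a Y ^+ 2 * b Y ^+ 2).
  by apply: Ex_ge0 => Y; apply: mulr_ge0; apply: sqr_ge0.
have A40 : 0 <= Ex (fun Y => a Y ^+ 4) by apply: Ex_ge0 => Y; apply: exprn_even_ge0.
have B40 : 0 <= Ex (fun Y => b Y ^+ 4) by apply: Ex_ge0 => Y; apply: exprn_even_ge0.
move: A0 B0 C0 A40 B40 IHa IHb.
move: (Ex (fun Y => a Y ^+ 2)) (Ex (fun Y => b Y ^+ 2)) (Ex (fun Y => a Y ^+ 2 * b Y ^+ 2))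
   (Ex (fun Y => a Y ^+ 4)) (Ex (fun Y => b Y ^+ 4)) => A B C A4 B4 A0 B0 C0 A40 B40 hA hB hC.
have K0 : (0 : R) < 9 ^+ d by rewrite exprn_gt0 // ltr0n.
rewrite exprS in hA *.
have C_le : C <= 3 * 9 ^+ d * (A * B).
  have n0 : 0 <= 3 * 9 ^+ d * (A * B) by rewrite !mulr_ge0 // ltW.
  rewrite -(@ler_pXn2r _ 2) // ?nnegrE //.
  apply: (le_trans hC); apply: le_trans (ler_pM A40 B40 hA hB) _.
  by rewrite le_eqVlt; apply/orP; left; apply/eqP; ring.
have : 9 * 9 ^+ d * (A + B) ^+ 2 - (9 * 9 ^+ d * A ^+ 2 + 9 ^+ d * B ^+ 2 + 6 * (3 * 9 ^+ d * (A * B))) = 9 ^+ d * (8 * B ^+ 2) by ring.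
have : 0 <= 9 ^+ d * (8 * B ^+ 2) by rewrite !mulr_ge0 ?sqr_ge0 // ltW.
lra.
Qed.

(** Apply [bonami] to f ^ (2 ^ i), of degree d 2 ^ i: each doubling squares the previous bound. The
    exponents fit because 2 * 4 ^ i + 2 ^ i <= 4 ^ (i + 1). *)
Lemma hypercontractive d f i : deg_le (enum V) d f ->
  Ex (fun Y => f Y ^+ (2 ^ i.+1)) <=
    9 ^+ (d * 4 ^ i) * Ex (fun Y => f Y ^+ 2) ^+ (2 ^ i).
Proof.
move=> hd; elim: i => [|i IH].
  rewrite !expn0 !expr1 ler_peMl ?exprn_ege1 ?ler1n //.
  by apply: Ex_ge0 => Y; apply: sqr_ge0.
have E1 : Ex (fun Y => f Y ^+ (2 ^ i.+2)) = Ex (fun Y => (f Y ^+ (2 ^ i)) ^+ 4).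
  by apply: eq_Ex => Y; rewrite -exprM; congr (_ ^+ _); rewrite !expnS; lia.
have E2 : Ex (fun Y => f Y ^+ (2 ^ i.+1)) = Ex (fun Y => (f Y ^+ (2 ^ i)) ^+ 2).
  by apply: eq_Ex => Y; rewrite -exprM; congr (_ ^+ _); rewrite !expnS; lia.
rewrite E1; apply: le_trans (bonami (enum_uniq V) (deg_leX (2 ^ i) hd)) _.
rewrite -E2.
have p0 : 0 <= Ex (fun Y => f Y ^+ (2 ^ i.+1)).
  by rewrite E2; apply: Ex_ge0 => Y; apply: sqr_ge0.
have q0 : 0 <= Ex (fun Y => f Y ^+ 2) by apply: Ex_ge0 => Y; apply: sqr_ge0.
have := lerXn2r 2 p0 (le_trans p0 IH) IH => h.
apply: le_trans (ler_wpM2l _ h) _; first by rewrite exprn_ge0 // ler0n.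
rewrite exprMn -!exprM mulrA -exprD.
have -> : (2 ^ i * 2 = 2 ^ i.+1)%N by rewrite expnS mulnC.
apply: ler_wpM2r; first exact: exprn_ge0.
apply: ler_weXn2l; first by rewrite ler1n.
have : (d * 2 ^ i <= d * 4 ^ i)%N.
  by rewrite leq_mul2l -[4%N]/(2 * 2)%N expnMn leq_pmulr ?orbT // expn_gt0.
by rewrite expnS; lia.
Qed.

End Bonami.

(** * The perturbed random point *)

Section SetProducts.
Variables (V : finType).

Lemma prodD_subset (R : comNzRingType) (S : {set V}) (f g : V -> R) :
  \prod_(v in S) (f v + g v) =
  \sum_(A : {set V} | A \subset S) (\prod_(v in S :\: A) f v) * \prod_(v in A) g v.
Proof.
(* Extending f by 1 and g by 0 outside S makes the product run over all of V and kills every A not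
   contained in S. *)
pose f' v := if v \in S then f v else 1; pose g' v := if v \in S then g v else 0.
have -> : \prod_(v in S) (f v + g v) = \prod_v (g' v + f' v).
  rewrite big_mkcond /=; apply: eq_bigr => v _; rewrite /f' /g'.
  by case: ifP; rewrite ?add0r // addrC.
rewrite bigA_distr [RHS]big_mkcond /=; apply: eq_bigr => A _.
case: ifPn => [AS|/subsetPn[x xA xS]]; last first.
  by rewrite (bigD1 x) //= xA /g' (negPf xS) mul0r.
rewrite (bigID (mem A)) /= mulrC; congr (_ * _).
  rewrite (bigID (mem S)) /= mulrC big1 ?mul1r.
    apply: eq_big => v; first by rewrite inE.
    by case/andP=> /negPf vA vS; rewrite vA /f' vS.
  by move=> v /andP[/negPf vA /negPf vS]; rewrite vA /f' vS.
apply: eq_bigr => v vA; rewrite vA /g'.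
by rewrite (subsetP AS).
Qed.

Lemma prod_le_sum_exp (R : realFieldType) (S : {set V}) (f : V -> R) :
  S != set0 -> (forall v, 0 <= f v) ->
  \prod_(v in S) f v <= \sum_(v in S) f v ^+ #|S|.
Proof.
case/set0Pn=> v0 v0S f0.
case: (arg_maxP f v0S) => v vS vmax.
rewrite [leRHS](bigD1 v) //= -[leLHS]addr0; apply: lerD; last first.
  by apply: sumr_ge0 => u _; rewrite exprn_ge0.
rewrite -prodr_const; apply: ler_prod => u uS.
by rewrite f0 /=; apply: vmax.
Qed.

Lemma prod_max1_le (R : realFieldType) (S : {set V}) (f : V -> R) (n : nat) :
  (#|S| <= n)%N -> (forall v, 0 <= f v) ->
  \prod_(v in S) Num.max 1 (f v) <= 1 + \sum_(v in S) f v ^+ n.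
Proof.
move=> Sn f0; have s0 : 0 <= \sum_(v in S) f v ^+ n.
  by apply: sumr_ge0 => u _; rewrite exprn_ge0.
have [le1|] := boolP [forall v in S, f v <= 1].
  rewrite big1 ?lerDl // => v vS; apply/max_idPl.
  by have /forall_inP := le1; apply.
rewrite negb_forall => /existsP[v0]; rewrite negb_imply -ltNge => /andP[v0S f1].
case: (arg_maxP f v0S) => v vS vmax.
have fv1 : 1 <= f v by apply: le_trans (ltW f1) _; apply: vmax.
apply: (@le_trans _ _ (f v ^+ n)); last first.
  rewrite (bigD1 v) //= addrCA lerDl addr_ge0 //.
  by apply: sumr_ge0 => u _; rewrite exprn_ge0.
apply: (@le_trans _ _ (f v ^+ #|S|)); last exact: ler_weXn2l.
rewrite -prodr_const; apply: ler_prod => u uS.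
rewrite le_max ler01 /= ge_max fv1 /=; exact: vmax.
Qed.

End SetProducts.

Section Process.
Variables (R : realFieldType) (V : finType).
Implicit Types (S T Y A Q e : {set V}) (v x : V).

Lemma Ex_chi S : S != set0 -> Ex (chi R S) = 0.
Proof.
by case/set0Pn=> x xS; apply: (@Ex_odd _ _ x) => Y; rewrite chi_flip xS.
Qed.

Lemma Ex_chiM S T : Ex (fun Y => chi R S Y * chi R T Y) = (S == T)%:R.
Proof.
have [->|ST] := eqVneq S T.
  by rewrite (eq_Ex (g := fun=> 1)) ?Ex_const // => Y; rewrite chiM.
have [x xST] : exists x, (x \in S) != (x \in T).
  apply/existsP; apply: contraNT ST => /existsPn h; apply/eqP/setP => x.
  by have := h x; rewrite negbK => /eqP.
apply: (@Ex_odd _ _ x) => Y; rewrite !chi_flip.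
by move: xST; do 2!case: (x \in _); rewrite //= ?mulNr ?mulrN.
Qed.

(** The vertex x occurs in exactly one of the characters, so flipping it negates the product. *)
Lemma Ex_chi_prod0 Q A (g : V -> {set V}) a x :
  a \in A -> x \in g a -> x \notin Q ->
  (forall b, b \in A -> b != a -> x \notin g b) ->
  Ex (fun Y => chi R Q Y * \prod_(b in A) chi R (g b) Y) = 0.
Proof.
move=> aA xga xQ h; apply: (@Ex_odd _ _ x) => Y.
rewrite chi_flip (negPf xQ) -mulrN; congr (_ * _).
rewrite !(bigD1 a aA) /= chi_flip xga mulNr; congr (- (_ * _)).
by apply: eq_bigr => b /andP[bA ba]; rewrite chi_flip (negPf (h b bA ba)).
Qed.

(** * Link forms of a family of sets with small intersections *)

Section Family.
Variables (T : {set {set V}}) (des : {set V} -> V) (k s l J : nat).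
Hypothesis T_card : {in T, forall S, #|S| = s}.
Hypothesis T_des : {in T, forall S, des S \in S}.
Hypothesis T_inter : {in T &, forall S1 S2, S1 != S2 -> (#|S1 :&: S2| < l)%N}.
Hypothesis s_ge : (J * l <= s)%N.
Hypothesis l_gt0 : (0 < l)%N.

Definition desfam v := [set S in T | des S == v].
(** Up to the factor theta this is the perturbation x_v of the overview, with [des S] in the role of
    the last vertex of S. *)
Definition linkform v Y : R := \sum_(S in desfam v) chi R (S :\ v) Y.
Definition near e := [set S in T | (l <= #|S :&: e|)%N].

(** A set of [near e] is determined by its trace on e: two sets with the same trace would meet in at
    least l vertices. *)
Lemma card_near e : (#|near e| <= 2 ^ #|e|)%N.
Proof.
have <- : #|[set S :&: e | S in near e]| = #|near e|; last first.
  rewrite -card_powerset; apply/subset_leq_card/subsetP => _ /imsetP[S _ ->].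
  by rewrite inE subsetIr.
apply: card_in_imset.
move=> S1 S2; rewrite !inE => /andP[S1T c1] /andP[S2T c2] eq12.
apply/eqP; apply: contraTT c1 => ne; rewrite -ltnNge.
apply: leq_ltn_trans (T_inter S1T S2T ne).
apply: subset_leq_card; rewrite subsetI subsetIl eq12; exact: subsetIl.
Qed.

Lemma desfam_mem v S : S \in desfam v -> [/\ S \in T, des S = v & v \in S].
Proof.
by rewrite inE => /andP[ST /eqP dS]; split=> //; rewrite -dS T_des.
Qed.

(* Flipping the sign of a vertex of [g a] outside e and outside the other [g b]
   negates the product; if [g a] meets e in fewer than l vertices, the small pairwise
   intersections leave such a vertex. *)
Lemma near_of_nonzero e Q A (g : V -> {set V}) a :
  Q \subset e -> A \subset e -> (#|A| <= J)%N ->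
  (forall b, b \in A -> g b \in desfam b) -> a \in A ->
  Ex (fun Y => chi R Q Y * \prod_(b in A) chi R (g b :\ b) Y) != 0 ->
  g a \in near e.
Proof.
move=> Qe Ae AJ gT aA ne0.
have [gaT _ aga] := desfam_mem (gT a aA).
rewrite inE gaT /= leqNgt; apply: contra ne0 => small.
have [x xga] : exists x, x \in (g a :\: e) :\: \bigcup_(b in A :\ a) g b.
  apply/set0Pn; apply/eqP => h0.
  (* Without such a vertex, [g a] is covered by at most l - 1 vertices of e and at most l - 1
     vertices of each of the other |A| - 1 sets, so s <= J (l - 1), against J l <= s. *)
  have sub : g a \subset (g a :&: e) :|: \bigcup_(b in A :\ a) (g a :&: g b).
    apply/subsetP => x xga; have : x \in (g a :\: e) :\: \bigcup_(b in A :\ a) g b = false.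
      by rewrite h0 inE.
    rewrite !inE xga /=.
    case: (x \in e); rewrite //= andbT => /negbFE/bigcupP[b bA xgb].
    by apply/bigcupP; exists b; rewrite // inE xga.
  have := subset_leq_card sub; rewrite (T_card gaT) => le1.
  have : (s <= (l - 1) + #|A :\ a| * (l - 1))%N.
    apply: leq_trans le1 _; apply: leq_trans (leq_card_setU _ _) _.
    apply: leq_add; first by lia.
    have : (#|\bigcup_(b in A :\ a) (g a :&: g b)| <= \sum_(b in A :\ a) #|g a :&: g b|)%N.
      elim/big_rec2: _ => [|b m B _ ih]; first by rewrite cards0.
      by apply: leq_trans (leq_card_setU _ _) _; rewrite leq_add2l.
    move=> h; apply: leq_trans h _; rewrite -sum_nat_const; apply: leq_sum => b.
    rewrite !inE => /andP[ba bA].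
    have [gbT db _] := desfam_mem (gT b bA); have [_ da _] := desfam_mem (gT a aA).
    have : (#|g a :&: g b| < l)%N.
      by apply: T_inter => //; apply: contra ba => /eqP e1; rewrite -db -e1 da.
    by move=> lt; rewrite subn1 -ltnS (prednK l_gt0).
  have := cardsD1 a A; rewrite aA; nia.
move: xga; rewrite !inE => /andP[xU /andP[xe xga]].
apply/eqP; apply: (@Ex_chi_prod0 _ _ (fun b => g b :\ b) a x aA).
- by rewrite !inE xga andbT; apply: contraNneq xe => ->; apply: (subsetP Ae).
- by apply: contra xe => /(subsetP Qe).
- move=> b bA ba; rewrite !inE negb_and; apply/orP; right.
  by apply: contra xU => xgb; apply/bigcupP; exists b; rewrite // !inE ba.
Qed.

(** Expanding the product gives one term, of absolute value at most 1, for each choice of sets [g v]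
    in [desfam v]. A term with nonzero mean chooses only sets of [near e], so the number of such
    terms is bounded in k alone, however large T is. *)
Lemma Ex_linkforms e Q A : #|e| = k -> Q \subset e -> A \subset e -> (#|A| <= J)%N ->
  `|Ex (fun Y => chi R Q Y * \prod_(v in A) linkform v Y)| <= ((2 ^ k) ^ k)%:R.
Proof.
move=> ek Qe Ae AJ.
pose fam := pfamily (set0 : {set V}) (mem A) (fun v => [pred S | S \in desfam v]).
have -> : Ex (fun Y => chi R Q Y * \prod_(v in A) linkform v Y) =
    \sum_(g in fam) Ex (fun Y => chi R Q Y * \prod_(v in A) chi R (g v :\ v) Y).
  rewrite -Ex_sum; apply: eq_Ex => Y.
  by rewrite /linkform (big_distr_big_dep set0) /= mulr_sumr.
pose nf := pffun_on (set0 : {set V}) (mem A) (mem (near e)).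
apply: (@le_trans _ _ (\sum_(g in nf) 1)); last first.
  rewrite sumr_const ler_nat card_pffun_on.
  apply: leq_trans (_ : ((2 ^ k) ^ #|A| <= _)%N); last first.
    by rewrite leq_pexp2l ?expn_gt0 // -ek subset_leq_card.
  case: (posnP #|A|) => [->//|A0].
  by rewrite leq_exp2r // -ek card_near.
apply: le_trans (ler_norm_sum _ _ _) _.
rewrite big_mkcond [leRHS]big_mkcond /=; apply: ler_sum => g _.
case: ifP => [gfam|_]; last by case: ifP; rewrite ?ler01.
have /pfamilyP[supp gA] := gfam.
have [->|ne0] := eqVneq (Ex (fun Y => chi R Q Y * \prod_(v in A) chi R (g v :\ v) Y)) 0.
  by rewrite normr0; case: ifP; rewrite ?ler01.
have -> : g \in nf.
  apply/pffun_onP; split=> // S /imageP[a aA ->].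
  by apply: (near_of_nonzero Qe Ae AJ _ _ ne0) => // b bA; apply: gA.
apply: le_trans (Ex_norm _) _; rewrite -[leRHS](Ex_const V).
apply: Ex_le => Y; rewrite normrM normr_chi mul1r normr_prod big1 // => v _.
by rewrite normr_chi.
Qed.

(** Orthogonality of the characters. This degree-one correlation is the source of the gain. *)
Lemma Ex_chi_linkform S v : v \in S ->
  Ex (fun Y => chi R (S :\ v) Y * linkform v Y) = ((S \in T) && (des S == v))%:R.
Proof.
move=> vS; rewrite /linkform.
rewrite (eq_Ex (g := fun Y => \sum_(S2 in desfam v) chi R (S :\ v) Y * chi R (S2 :\ v) Y)); last first.
  by move=> Y; rewrite mulr_sumr.
rewrite Ex_sum (eq_bigr (fun S2 => (S2 == S)%:R)); last first.
  move=> S2 /desfam_mem[_ _ vS2]; rewrite Ex_chiM; congr (_%:R).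
  have -> // : (S :\ v == S2 :\ v) = (S2 == S).
  apply/eqP/eqP => [h|-> //].
  by rewrite -(setD1K vS) -(setD1K vS2) h.
have [/andP[ST dS]|hS] := boolP (_ && _).
  rewrite (bigD1 S) ?inE ?ST //= eqxx big1 ?addr0 // => S2 /andP[_ /negPf ->] //.
rewrite big1 // => S2; rewrite inE => h.
by case: eqP => // e1; rewrite -e1 h in hS.
Qed.

Lemma Ex_linkform_sqr v : Ex (fun Y => linkform v Y ^+ 2) = #|desfam v|%:R.
Proof.
rewrite /linkform (eq_Ex (g := fun Y => \sum_(S1 in desfam v) chi R (S1 :\ v) Y * linkform v Y)).
  rewrite Ex_sum (eq_bigr (fun=> 1)) ?sumr_const // => S SD.
  have [ST dS vS] := desfam_mem SD.
  by rewrite Ex_chi_linkform // ST dS eqxx.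
by move=> Y; rewrite expr2 mulr_suml.
Qed.

Lemma Ex_linkform_exp v i :
  Ex (fun Y => linkform v Y ^+ (2 ^ i.+1)) <= 9 ^+ (s * 4 ^ i) * #|desfam v|%:R ^+ (2 ^ i).
Proof.
rewrite -Ex_linkform_sqr; apply: hypercontractive.
apply: deg_le_sum => S /desfam_mem[ST _ vS]; apply: deg_le_chi.
by rewrite -(T_card ST) subset_leq_card // subsetDl.
Qed.


(** * Moments of the perturbation, truncation, and the expected gain *)

Section Moments.
Variables (th nu : R) (i : nat).
Hypotheses (th0 : 0 <= th) (th1 : th <= 1) (nu0 : 0 < nu) (nu1 : nu <= 1).
Hypothesis th_nu : forall v, th ^+ 2 * #|desfam v|%:R <= nu ^+ 2.
Hypotheses (s_le : (s <= k)%N) (k_le : (k <= 2 ^ i.+1)%N) (J_lt : (J < 2 ^ i.+1)%N).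

Let P := (2 ^ i.+1)%N.
Definition moment_const : R := 9 ^+ (k * 4 ^ i).
Let K := moment_const.
Definition pert v Y : R := th * linkform v Y.

Lemma moment_const_ge1 : 1 <= K.
Proof. by rewrite /K exprn_ege1 // ler1n. Qed.

Lemma exprP_ge0 (a : R) : 0 <= a ^+ P.
Proof. by rewrite exprn_even_ge0 // /P expnS oddM. Qed.

Lemma exprP_norm (a : R) : `|a| ^+ P = a ^+ P.
Proof. by rewrite -normrX ger0_norm // exprP_ge0. Qed.

Lemma Ex_pert_exp v : Ex (fun Y => pert v Y ^+ P) <= K * nu ^+ P.
Proof.
rewrite (eq_Ex (g := fun Y => th ^+ P * linkform v Y ^+ P)); last first.
  by move=> Y; rewrite exprMn.
rewrite ExZ; have := Ex_linkform_exp v i; rewrite -/P => h.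
apply: le_trans (ler_wpM2l (exprP_ge0 th) h) _.
rewrite mulrCA /P !expnS !exprM -exprMn.
have h1 : (th ^+ 2 * #|desfam v|%:R) ^+ (2 ^ i) <= (nu ^+ 2) ^+ (2 ^ i).
  by apply: lerXn2r; rewrite ?nnegrE ?exprn_ge0 ?mulr_ge0 ?exprn_ge0 // ?ler0n // ltW.
have h2 : (9 : R) ^+ s ^+ (4 ^ i) <= K.
  by rewrite /K /moment_const -exprM ler_weXn2l ?ler1n // leq_mul2r s_le orbT.
by apply: ler_pM => //; rewrite !exprn_ge0 ?mulr_ge0 ?exprn_ge0 ?ler0n.
Qed.

(** After scaling by [nu] the bound is t ^ a <= 1 + t ^ P for t >= 0 and a <= P; the moment of order
    P comes from hypercontractivity. *)
Lemma Ex_pert_norm v a : (J < a)%N -> (a <= P)%N ->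
  Ex (fun Y => `|pert v Y| ^+ a) <= (1 + K) * nu ^+ J.+1.
Proof.
move=> Ja aP.
apply: (@le_trans _ _ (Ex (fun Y => nu ^+ a * (1 + nu ^- P * pert v Y ^+ P)))).
  apply: Ex_le => Y.
  set t := `|pert v Y| / nu.
  have t0 : 0 <= t by rewrite divr_ge0 // ltW.
  have e : `|pert v Y| = nu * t by rewrite /t mulrC divfK // gt_eqF.
  clearbody t; rewrite -(exprP_norm (pert v Y)) e !exprMn mulKf ?expf_neq0 ?gt_eqF //.
  have np : 0 <= nu ^+ a by rewrite exprn_ge0 // ltW.
  have [t1|t1] := leP t 1.
    apply: ler_wpM2l => //; apply: (@le_trans _ _ 1); first exact: exprn_ile1.
    by rewrite lerDl exprn_ge0.
  apply: ler_wpM2l => //; apply: (@le_trans _ _ (t ^+ P)); first by apply: ler_weXn2l => //; apply: ltW.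
  by rewrite lerDr.
rewrite ExZ ExD Ex_const ExZ.
have h : nu ^- P * Ex (fun Y => pert v Y ^+ P) <= K.
  by rewrite mulrC ler_pdivrMr ?exprn_gt0 // Ex_pert_exp.
have h2 : nu ^+ a <= nu ^+ J.+1 by apply: ler_wiXn2l => //; apply: ltW.
rewrite mulrC; apply: ler_pM => //.
- rewrite addr_ge0 // mulr_ge0 ?invr_ge0 ?exprn_ge0 ?(ltW nu0) //.
  by apply: Ex_ge0 => Y; apply: exprP_ge0.
- by rewrite exprn_ge0 // ltW.
- by rewrite lerD2l.
Qed.

(** The first summand bounds a term with 2 <= |A| <= J, the second a term with |A| > J. *)
Definition err_prod : R := ((2 ^ k) ^ k)%:R * th ^+ 2 + k%:R * ((1 + K) * nu ^+ J.+1).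

Lemma err_prod_ge0 : 0 <= err_prod.
Proof.
have := moment_const_ge1 => K1.
apply: addr_ge0; first by rewrite mulr_ge0 ?ler0n // exprn_ge0.
rewrite !mulr_ge0 ?ler0n ?exprn_ge0 ?(ltW nu0) //; lra.
Qed.

Lemma Ex_pert_prod e S A : #|e| = k -> S \subset e -> A \subset S -> (1 < #|A|)%N ->
  `|Ex (fun Y => chi R (S :\: A) Y * \prod_(v in A) pert v Y)| <= err_prod.
Proof.
move=> ek Se AS A1; have Ae := subset_trans AS Se.
have Qe : S :\: A \subset e by apply: subset_trans Se; apply: subsetDl.
have K1 := moment_const_ge1.
have e10 : 0 <= ((2 ^ k) ^ k)%:R * th ^+ 2 by rewrite mulr_ge0 ?ler0n // exprn_ge0.
have e20 : 0 <= (1 + K) * nu ^+ J.+1.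
  by rewrite mulr_ge0 ?exprn_ge0 ?(ltW nu0) //; lra.
have [AJ|AJ] := leqP #|A| J.
  rewrite (eq_Ex (g := fun Y => th ^+ #|A| * (chi R (S :\: A) Y * \prod_(v in A) linkform v Y))); last first.
    by move=> Y; rewrite /pert big_split /= prodr_const; ring.
  rewrite ExZ normrM (ger0_norm (exprn_ge0 _ th0)) mulrC.
  apply: le_trans (_ : ((2 ^ k) ^ k)%:R * th ^+ 2 <= _); last first.
    by rewrite /err_prod lerDl mulr_ge0 // ler0n.
  apply: ler_pM; rewrite ?normr_ge0 ?exprn_ge0 //; first exact: Ex_linkforms ek Qe Ae AJ.
  exact: ler_wiXn2l.
apply: le_trans (Ex_norm _) _.
apply: (@le_trans _ _ (Ex (fun Y => \sum_(v in A) `|pert v Y| ^+ #|A|))).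
  apply: Ex_le => Y; rewrite normrM normr_chi mul1r normr_prod.
  apply: prod_le_sum_exp => //; rewrite -card_gt0; exact: ltnW.
have Ak : (#|A| <= k)%N by rewrite -ek subset_leq_card.
rewrite Ex_sum; apply: (@le_trans _ _ (\sum_(v in A) ((1 + K) * nu ^+ J.+1))).
  apply: ler_sum => v vA; apply: Ex_pert_norm => //; exact: leq_trans Ak k_le.
rewrite sumr_const -[_ *+ #|A|]mulr_natl.
rewrite /err_prod -[leLHS]add0r; apply: lerD => //.
by apply: ler_wpM2r => //; rewrite ler_nat.
Qed.

(** Expand over the set A of vertices of S at which the perturbation is chosen. The empty A has mean
    0, a singleton contributes - [th] exactly when S is in T and A is its designated vertex, and
    larger A are errors. The factor 2 ^ - |S| offsets the number of subsets A. *)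
Lemma Ex_prod_shift e S : #|e| = k -> S \subset e -> S != set0 ->
  Ex (fun Y => \prod_(v in S) ((sgn R Y v - pert v Y) / 2)) <=
    (if S \in T then - (th / 2 ^+ s) else 0) + err_prod.
Proof.
move=> ek Se S0.
have p2 : 0 < (2 : R) ^+ #|S| by rewrite exprn_gt0.
rewrite (eq_Ex (g := fun Y => 2 ^- #|S| * \sum_(A : {set V} | A \subset S)
    chi R (S :\: A) Y * \prod_(v in A) - pert v Y)); last first.
  move=> Y; rewrite big_split /= prodr_const exprVn mulrC.
  by rewrite prodD_subset.
rewrite ExZ Ex_sum mulrC ler_pdivrMr //.
apply: (@le_trans _ _ (\sum_(A : {set V} | A \subset S)
  ((if (S \in T) && (A == [set des S]) then - th else 0) + err_prod))); last first.
  rewrite big_split /= sumr_const.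
  have -> : #|[pred A : {set V} | A \subset S]| = (2 ^ #|S|)%N.
    by rewrite -card_powerset; apply: eq_card => A; rewrite !inE.
  rewrite mulrDl -[err_prod *+ _]mulr_natr natrX; apply: lerD => //.
  case: ifP => ST; last by rewrite mul0r big1.
  rewrite (bigD1 [set des S]) ?sub1set ?T_des //= eqxx big1; last first.
    by move=> A /andP[_ /negPf ->].
  by rewrite addr0 T_card // mulNr mulrAC mulfK // gt_eqF // -(T_card ST).
apply: ler_sum => A AS.
have e0 := err_prod_ge0.
have -> : Ex (fun Y => chi R (S :\: A) Y * \prod_(v in A) - pert v Y) =
    (-1) ^+ #|A| * Ex (fun Y => chi R (S :\: A) Y * \prod_(v in A) pert v Y).
  by rewrite -ExZ; apply: eq_Ex => Y; rewrite prodrN mulrCA.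
have [A1|A1] := ltnP 1 #|A|.
  have -> : (S \in T) && (A == [set des S]) = false.
    by apply/negbTE; rewrite negb_and; apply/orP; right; apply: contraTneq A1 => ->; rewrite cards1.
  rewrite add0r; apply: le_trans (ler_norm _) _.
  by rewrite normrM normrX normrN1 expr1n mul1r; apply: (Ex_pert_prod ek).
have [A0|A0] := posnP #|A|.
  move/cards0_eq: A0 => ->; rewrite cards0 expr0 mul1r.
  have -> : set0 == [set des S] = false.
    by apply/negbTE; rewrite eq_sym -card_gt0 cards1.
  rewrite andbF add0r (eq_Ex (g := chi R S)) ?Ex_chi // => Y.
  by rewrite big_set0 mulr1 setD0.
have /cards1P[v Av] : #|A| == 1%N by rewrite eqn_leq A1 A0.
rewrite Av cards1 expr1 mulN1r in AS *; rewrite sub1set in AS.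
rewrite (eq_Ex (g := fun Y => th * (chi R (S :\ v) Y * linkform v Y))); last first.
  by move=> Y; rewrite big_set1 /pert mulrCA.
rewrite ExZ Ex_chi_linkform // (inj_eq set1_inj) [des S == v]eq_sym.
by case: ifP => _; rewrite ?mulr1 ?mulr0 ?oppr0 ?add0r ?lerDl.
Qed.

(** Truncation keeps [point] in [-1, 1]: it is half the difference of two numbers in that
    interval. *)
Definition clip v Y : R := if `|pert v Y| <= 1 then pert v Y else 0.

Lemma normr_clip v Y : `|clip v Y| <= 1.
Proof. by rewrite /clip; case: ifP => //; rewrite normr0 ler01. Qed.

Definition point Y v : R := (sgn R Y v - clip v Y) / 2.

Lemma normr_half_shift (a : R) v Y : `|(sgn R Y v - a) / 2| <= Num.max 1 `|a|.
Proof.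
rewrite normrM normfV (ger0_norm (ler0n R 2)) ler_pdivrMr //.
apply: le_trans (ler_normB _ _) _; rewrite normr_sgn.
by rewrite maxEle; case: ifP => h; lra.
Qed.

Lemma normr_point Y v : `|point Y v| <= 1.
Proof.
apply: le_trans (normr_half_shift _ _ _) _.
by rewrite ge_max lexx normr_clip.
Qed.

(** The two products agree unless some |[pert v Y]| exceeds 1 on S. In that case the sum M of the
    P-th powers is at least 1, the left product is at most 1 and the right one at least - 1 - M, so
    3 M covers the difference. *)
Lemma clip_error S Y : (#|S| <= k)%N ->
  \prod_(v in S) point Y v <=
    \prod_(v in S) ((sgn R Y v - pert v Y) / 2) + 3 * \sum_(v in S) pert v Y ^+ P.
Proof.
move=> Sk; have s0 : 0 <= \sum_(v in S) pert v Y ^+ P.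
  by apply: sumr_ge0 => v _; apply: exprP_ge0.
have [le1|] := boolP [forall v in S, `|pert v Y| <= 1].
  rewrite (eq_bigr (fun v => (sgn R Y v - pert v Y) / 2)); first by rewrite lerDl mulr_ge0.
  by move=> v vS; rewrite /point /clip; have /forall_inP -> := le1.
rewrite negb_forall => /existsP[v]; rewrite negb_imply -ltNge => /andP[vS v1].
have s1 : 1 <= \sum_(v in S) pert v Y ^+ P.
  rewrite (bigD1 v) //= -[leLHS]addr0; apply: lerD.
    by rewrite -exprP_norm exprn_ege1 // ltW.
  by apply: sumr_ge0 => u _; apply: exprP_ge0.
have b1 : `|\prod_(v in S) point Y v| <= 1.
  rewrite normr_prod; apply: prodr_ile1 => v' _.
  by rewrite normr_ge0 normr_point.
have b2 : `|\prod_(v in S) ((sgn R Y v - pert v Y) / 2)| <= 1 + \sum_(v in S) pert v Y ^+ P.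
  have -> : \sum_(v in S) pert v Y ^+ P = \sum_(v in S) `|pert v Y| ^+ P.
    by apply: eq_bigr => u _; rewrite exprP_norm.
  rewrite normr_prod.
  apply: le_trans (prod_max1_le (leq_trans Sk k_le) (fun v => normr_ge0 (pert v Y))).
  by apply: ler_prod => u _; rewrite normr_ge0 normr_half_shift.
move: b1 b2; rewrite !ler_norml => /andP[_ b1] /andP[b2 _]; lra.
Qed.

Definition proc_const : R := ((2 ^ k) ^ k)%:R + 4 * k%:R * (1 + K).

Lemma Ex_prod_point e S : #|e| = k -> S \subset e -> S != set0 ->
  Ex (fun Y => \prod_(v in S) point Y v) <=
    (if S \in T then - (th / 2 ^+ s) else 0) + proc_const * (th ^+ 2 + nu ^+ J.+1).
Proof.
move=> ek Se S0; have Sk : (#|S| <= k)%N by rewrite -ek subset_leq_card.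
apply: le_trans (Ex_le (fun Y => clip_error Y Sk)) _.
rewrite ExD ExZ Ex_sum.
have h1 := Ex_prod_shift ek Se S0.
have h2 : \sum_(v in S) Ex (fun Y => pert v Y ^+ P) <= k%:R * (K * nu ^+ J.+1).
  apply: (@le_trans _ _ (\sum_(v in S) (K * nu ^+ J.+1))).
    apply: ler_sum => v _; apply: le_trans (Ex_pert_exp v) _.
    apply: ler_wpM2l; first by have := moment_const_ge1; lra.
    by apply: ler_wiXn2l => //; apply: ltW.
  rewrite sumr_const -[_ *+ #|S|]mulr_natl; apply: ler_wpM2r; last by rewrite ler_nat.
  rewrite mulr_ge0 ?exprn_ge0 ?(ltW nu0) //; have := moment_const_ge1; lra.
apply: (@le_trans _ _ ((if S \in T then - (th / 2 ^+ s) else 0) + err_prod + 3 * (k%:R * (K * nu ^+ J.+1)))).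
  by apply: lerD => //; apply: ler_wpM2l.
rewrite -addrA lerD2l /err_prod /proc_const.
have n0 : 0 <= nu ^+ J.+1 by rewrite exprn_ge0 // ltW.
have t0 : 0 <= th ^+ 2 by rewrite exprn_ge0.
have k0 : (0 : R) <= k%:R by rewrite ler0n.
have c0 : (0 : R) <= ((2 ^ k) ^ k)%:R by rewrite ler0n.
have K1 := moment_const_ge1.
move: (nu ^+ J.+1) (th ^+ 2) (k%:R : R) (((2 ^ k) ^ k)%:R : R) n0 t0 k0 c0 => n t a c n0 t0 a0 c0.
have -> : (c + 4 * a * (1 + K)) * (t + n) =
  c * t + a * ((1 + K) * n) + 3 * (a * (K * n)) + (c * n + 4 * (a * t) + 4 * (a * K * t) + 3 * (a * n)).
  by ring.
rewrite lerDl !addr_ge0 // !mulr_ge0 //; lra.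
Qed.

(** Sum [Ex_prod_point] over the edges and their subsets, then pick a sign vector that does at least
    as well as the average. Each edge has 2 ^ k subsets with coefficient at most 2, which gives the
    error term. *)
Lemma process (E : {set {set V}}) (b : {set V} -> {set V} -> R) (be : R) :
  {in E, forall e, #|e| = k} ->
  {in E, forall e S, 0 <= b e S <= 2} ->
  {in E, forall e S, b e S != 0 -> S \subset e /\ S != set0} ->
  {in E & T, forall e S, S \subset e -> be <= b e S} ->
  exists z : V -> R, (forall v, `|z v| <= 1) /\
    \sum_(e in E) \sum_S b e S * \prod_(v in S) z v <=
    - (th / 2 ^+ s * (be * \sum_(S in T) #|[set e in E | S \subset e]|%:R))
    + #|E|%:R * (2 ^+ k * (2 * (proc_const * (th ^+ 2 + nu ^+ J.+1)))).
Proof.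
move=> Ek b02 bS bbe.
suff h : Ex (fun Y => \sum_(e in E) \sum_S b e S * \prod_(v in S) point Y v) <=
    - (th / 2 ^+ s * (be * \sum_(S in T) #|[set e in E | S \subset e]|%:R))
    + #|E|%:R * (2 ^+ k * (2 * (proc_const * (th ^+ 2 + nu ^+ J.+1)))).
  have [Y hY] := Ex_exists h.
  by exists (point Y); split=> // v; apply: normr_point.
set C := proc_const * _.
have C0 : 0 <= C.
  rewrite mulr_ge0 ?addr_ge0 ?exprn_ge0 ?(ltW nu0) ?ler0n //.
  by rewrite !mulr_ge0 ?ler0n //; have := moment_const_ge1; lra.
have q0 : 0 <= th / 2 ^+ s by rewrite divr_ge0 // exprn_ge0.
rewrite Ex_sum; apply: (@le_trans _ _ (\sum_(e in E)
   (- (th / 2 ^+ s * (be * \sum_(S in T | S \subset e) 1)) + 2 ^+ k * (2 * C)))); last first.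
  rewrite big_split /= sumr_const -[_ *+ #|E|]mulr_natl lerD2r.
  rewrite sumrN lerN2 -mulr_sumr ler_wpM2l // -mulr_sumr.
  rewrite le_eqVlt; apply/orP; left; apply/eqP; congr (_ * _).
  under [RHS]eq_bigr do rewrite big_mkcondr.
  rewrite exchange_big /=; apply: eq_bigr => S ST.
  rewrite -sum1_card natr_sum big_mkcond [RHS]big_mkcond /=.
  by apply: eq_bigr => e _; rewrite inE; case: (e \in E).
apply: ler_sum => e eE; rewrite Ex_sum.
apply: (@le_trans _ _ (\sum_(S : {set V} | S \subset e)
    ((if S \in T then - (th / 2 ^+ s * be) else 0) + 2 * C))).
  rewrite [leRHS]big_mkcond /=; apply: ler_sum => S _.
  rewrite ExZ; case: ifPn => [Se|Se]; last first.
    have [->|/(bS e eE)[]] := eqVneq (b e S) 0; first by rewrite mul0r.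
    by rewrite (negPf Se).
  have /andP[b0 b2] := b02 e eE S.
  (* If the coefficient vanishes for a member of T inside e, then [be] <= 0 and the gain claimed for
     it is not positive. *)
  have [bz|/(bS e eE)[_ S0]] := eqVneq (b e S) 0.
    rewrite bz mul0r; case: ifP => ST; last by rewrite add0r mulr_ge0.
    have := bbe e S eE ST Se; rewrite bz => be0.
    by apply: addr_ge0; [rewrite oppr_ge0 mulr_ge0_le0 | rewrite mulr_ge0].
  apply: le_trans (ler_wpM2l b0 (Ex_prod_point (Ek e eE) Se S0)) _.
  rewrite mulrDr; apply: lerD; last exact: ler_wpM2r.
  case: ifP => ST; last by rewrite mulr0.
  rewrite mulrN lerN2 mulrC; apply: ler_wpM2r => //; exact: bbe.
rewrite big_split /= lerD //.
  rewrite -big_mkcondr /= sumr_const -[_ *+ _]mulr_natr mulNr -[_ * be * _]mulrA.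
  rewrite le_eqVlt; apply/orP; left; apply/eqP; congr (- (_ * (_ * _))).
  rewrite sumr_const; congr (_%:R); apply: eq_card => S.
  by rewrite unfold_in /= [RHS]unfold_in /= andbC.
rewrite sumr_const -[_ *+ _]mulr_natl -natrX.
have -> : #|[pred S : {set V} | S \subset e]| = (2 ^ k)%N.
  by rewrite -(Ek e eE) -card_powerset; apply: eq_card => A; rewrite !inE.
by [].
Qed.

End Moments.
End Family.
End Process.

(** * Rounding *)

Section Rounding.
Variables (R : realFieldType) (V : finType) (n : nat).
Implicit Types (f g : {ffun V -> 'I_n.+2}) (S e : {set V}) (v : V) (z : V -> R).

Let col0 : 'I_n.+2 := ord0.
Let col1 : 'I_n.+2 := lift ord0 ord0.

Lemma col10 : col1 == col0 = false. Proof. by []. Qed.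

(* A vertex v gets colour i with probability (1 + z_v eps i) / (n + 2). *)
Definition eps (i : 'I_n.+2) : R := if i == col0 then 1 else if i == col1 then -1 else 0.
Definition swap : 'I_n.+2 -> 'I_n.+2 := tperm col0 col1.

Lemma swapK : involutive swap. Proof. exact: tpermK. Qed.

Lemma eps_swap i : eps (swap i) = - eps i.
Proof.
rewrite /eps /swap; case: tpermP => [->|->|/eqP/negPf -> /eqP/negPf ->].
- by rewrite col10 eqxx.
- by rewrite eqxx col10 opprK.
- by rewrite oppr0.
Qed.

Lemma sum_eps : \sum_i eps i = 0.
Proof.
have : \sum_i eps i = - \sum_i eps i.
  rewrite -sumrN [LHS](reindex_inj (inv_inj swapK)) /=.
  by apply: eq_bigr => i _; rewrite eps_swap.
lra.
Qed.

Definition epsS S f : R := \prod_(v in S) eps (f v).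

Definition swap_at v f : {ffun V -> 'I_n.+2} :=
  [ffun u => if u == v then swap (f u) else f u].

Lemma swap_atK v : involutive (swap_at v).
Proof. by move=> f; apply/ffunP => u; rewrite !ffunE; case: eqP => // _; rewrite swapK. Qed.

Lemma epsS_swap_at v S f : v \in S -> epsS S (swap_at v f) = - epsS S f.
Proof.
move=> vS; rewrite /epsS !(bigD1 v vS) /= ffunE eqxx eps_swap mulNr; congr (- (_ * _)).
by apply: eq_bigr => u /andP[_ /negPf uv]; rewrite ffunE uv.
Qed.

Lemma sum_epsS0 (h : {ffun V -> 'I_n.+2} -> R) v S : v \in S ->
  (forall f, h (swap_at v f) = h f) -> \sum_f h f * epsS S f = 0.
Proof.
move=> vS hv; suff : \sum_f h f * epsS S f = - \sum_f h f * epsS S f by lra.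
rewrite -sumrN [LHS](reindex_inj (inv_inj (swap_atK v))) /=.
by apply: eq_bigr => f _; rewrite hv epsS_swap_at // mulrN.
Qed.

Definition swap_all f : {ffun V -> 'I_n.+2} := [ffun u => swap (f u)].

Lemma swap_allK : involutive swap_all.
Proof. by move=> f; apply/ffunP => u; rewrite !ffunE swapK. Qed.

Lemma epsS_swap_all S f : epsS S (swap_all f) = (-1) ^+ #|S| * epsS S f.
Proof.
by rewrite -prodrN; apply: eq_bigr => v _; rewrite ffunE eps_swap.
Qed.

(** This is [ncol] times the probability of f when the vertices are coloured independently with bias
    z. *)
Definition weight z f : R := \prod_v (1 + z v * eps (f v)).

Lemma weight_ge0 z f : (forall v, `|z v| <= 1) -> 0 <= weight z f.
Proof.
move=> z1; apply: prodr_ge0 => v _; have := z1 v; rewrite ler_norml => /andP[a b].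
by rewrite /eps; case: ifP => _; [|case: ifP => _]; lra.
Qed.

Lemma sum_weight_expand z (h : {ffun V -> 'I_n.+2} -> R) :
  \sum_f h f * weight z f = \sum_S (\sum_f h f * epsS S f) * \prod_(v in S) z v.
Proof.
transitivity (\sum_f \sum_S h f * epsS S f * \prod_(v in S) z v).
  apply: eq_bigr => f _; rewrite /weight.
  have -> : \prod_v (1 + z v * eps (f v)) = \prod_(v in [set: V]) (1 + z v * eps (f v)).
    by apply: eq_bigl => v; rewrite inE.
  rewrite prodD_subset mulr_sumr; apply: eq_big => [S|S _]; first by rewrite subsetT.
  by rewrite big1 // mul1r big_split /= -mulrA; congr (_ * _); rewrite mulrC.
by rewrite exchange_big /=; apply: eq_bigr => S _; rewrite mulr_suml.
Qed.

Lemma epsS0 f : epsS set0 f = 1. Proof. by rewrite /epsS big_set0. Qed.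

Definition ncol : R := (n.+2)%:R ^+ #|V|.

Lemma ncol_gt0 : 0 < ncol. Proof. by rewrite exprn_gt0 // ltr0n. Qed.

Lemma card_col : #|{: {ffun V -> 'I_n.+2}}|%:R = ncol.
Proof. by rewrite card_ffun card_ord natrX. Qed.

Lemma sum_weight z : \sum_f weight z f = ncol.
Proof.
rewrite /weight -(bigA_distr_bigA (fun v i => 1 + z v * eps i)).
rewrite (eq_bigr (fun=> (n.+2)%:R)); first by rewrite prodr_const.
by move=> v _; rewrite big_split /= sumr_const card_ord -mulr_sumr sum_eps mulr0 addr0.
Qed.

Definition mid e f := [forall i, (i != col0) ==> (i != col1) ==> [exists v in e, f v == i]].
Definition avoid (i : 'I_n.+2) e f := [forall v in e, f v != i].
Definition hit e f := [forall i, exists v in e, f v == i].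

Lemma hitE e f : hit e f = [&& mid e f, ~~ avoid col0 e f & ~~ avoid col1 e f].
Proof.
have av i : ~~ avoid i e f = [exists v in e, f v == i].
  rewrite negb_forall; apply: eq_existsb => v.
  by rewrite negb_imply negbK.
rewrite !av; apply/forallP/and3P => [h|[/forallP hm h0 h1] i].
  by split; rewrite ?h //; apply/forallP => i; rewrite h !implybT.
have [->//|i0] := eqVneq i col0; have [->//|i1] := eqVneq i col1.
by have := hm i; rewrite i0 i1.
Qed.

Lemma mid_swap_at v e f : mid e (swap_at v f) = mid e f.
Proof.
apply: eq_forallb => i; have [//|i0] := eqVneq i col0; have [//|i1] := eqVneq i col1.
rewrite /=; apply: eq_existsb => u; congr (_ && _); rewrite ffunE; case: (u == v) => //.
by rewrite (can2_eq swapK swapK) /swap tpermD // eq_sym.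
Qed.

Lemma mid_swap_all e f : mid e (swap_all f) = mid e f.
Proof.
apply: eq_forallb => i; have [//|i0] := eqVneq i col0; have [//|i1] := eqVneq i col1.
rewrite /=; apply: eq_existsb => u; congr (_ && _); rewrite ffunE.
by rewrite (can2_eq swapK swapK) /swap tpermD // eq_sym.
Qed.

Lemma avoid_swap_all e f : avoid col0 e (swap_all f) = avoid col1 e f.
Proof.
apply: eq_forallb => u; congr (_ ==> ~~ _); rewrite ffunE.
by rewrite (can2_eq swapK swapK) /swap tpermL.
Qed.

Definition good e S : {set {ffun V -> 'I_n.+2}} :=
  [set f | [&& mid e f, avoid col1 e f & [forall v in S, f v == col0]]].

(** When [col1] is absent from e, [epsS S f] is the indicator that all of S has colour [col0]. *)
Lemma sum_avoid1 e S : S \subset e ->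
  \sum_f (mid e f && avoid col1 e f)%:R * epsS S f = #|good e S|%:R.
Proof.
move=> Se; rewrite -sum1_card natr_sum [RHS]big_mkcond /=; apply: eq_bigr => f _.
rewrite inE; case: (mid e f) => /=; last by rewrite mul0r.
have [av|] := boolP (avoid col1 e f); last by rewrite mul0r.
rewrite mul1r /=; case: ifPn => [/forall_inP h|].
  by rewrite /epsS big1 // => v vS; rewrite /eps (h v vS).
rewrite negb_forall => /existsP[v]; rewrite negb_imply => /andP[vS /negPf fv].
rewrite /epsS (bigD1 v) //= /eps fv.
have /forall_inP/(_ v (subsetP Se v vS))/negPf -> := av.
by rewrite mul0r.
Qed.

(** Exchanging the two biased colours everywhere reduces this to [sum_avoid1], with one sign per
    vertex of S. *)
Lemma sum_avoid0 e S : S \subset e ->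
  \sum_f (mid e f && avoid col0 e f)%:R * epsS S f = (-1) ^+ #|S| * #|good e S|%:R.
Proof.
move=> Se; rewrite -sum_avoid1 // mulr_sumr [LHS](reindex_inj (inv_inj swap_allK)) /=.
by apply: eq_bigr => f _; rewrite mid_swap_all avoid_swap_all epsS_swap_all mulrCA.
Qed.

(* Swapping the two biased colours at a vertex of S cancels every colouring except
   those in which exactly one of these colours is missing from e. *)
Lemma sum_hit e S : S \subset e -> S != set0 ->
  \sum_f (hit e f)%:R * epsS S f = - ((1 + (-1) ^+ #|S|) * #|good e S|%:R).
Proof.
move=> Se S0; have [v vS] := set0Pn _ S0; have ve := subsetP Se v vS.
have hm : \sum_f (mid e f)%:R * epsS S f = 0.
  by apply: (sum_epsS0 vS) => f; rewrite mid_swap_at.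
rewrite mulrDl mul1r -sum_avoid0 // -sum_avoid1 //.
set X := _ + _; have -> : - X = \sum_f (mid e f)%:R * epsS S f - X by rewrite hm add0r.
rewrite /X -big_split /= -sumrN -big_split /=; apply: eq_bigr => f _; rewrite hitE.
case: (mid e f); rewrite /= ?mul0r ?addr0 ?subr0 //.
have [a0|] := boolP (avoid col0 e f); have [a1|] := boolP (avoid col1 e f);
  rewrite ?mul1r ?mul0r ?add0r ?addr0 ?subrr ?subr0 //.
(* Here both biased colours are missing from e, so [eps] vanishes on S. *)
rewrite (_ : epsS S f = 0) ?addr0 ?subr0 //.
rewrite /epsS (bigD1 v) //= /eps.
have /forall_inP/(_ v ve)/negPf -> := a0.
have /forall_inP/(_ v ve)/negPf -> := a1.
by rewrite mul0r.
Qed.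

Lemma sum_hit_out e S : ~~ (S \subset e) -> \sum_f (hit e f)%:R * epsS S f = 0.
Proof.
case/subsetPn => v vS ve; apply: (sum_epsS0 vS) => f; congr (_%:R); congr nat_of_bool.
apply: eq_forallb => i; apply: eq_existsb => u; rewrite ffunE.
by case: (eqVneq u v) => // ->; rewrite (negPf ve).
Qed.

(** The coefficient b(e, S) of the overview; the factor 1 + (-1) ^ |S| removes the odd sets. *)
Definition coeff e S : R :=
  if (S \subset e) && (S != set0) then (1 + (-1) ^+ #|S|) * #|good e S|%:R / ncol else 0.

Lemma coeff_ge0 e S : 0 <= coeff e S.
Proof.
rewrite /coeff; case: ifP => // _; rewrite !mulr_ge0 ?invr_ge0 ?(ltW ncol_gt0) //.
by rewrite -signr_odd; case: (odd _); rewrite /= ?expr0 ?expr1; lra.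
Qed.

Lemma coeff_le2 e S : coeff e S <= 2.
Proof.
rewrite /coeff; case: ifP => // _; rewrite ler_pdivrMr ?ncol_gt0 //.
apply: ler_pM => //.
- by rewrite -signr_odd; case: (odd _); rewrite /= ?expr0 ?expr1; lra.
- by rewrite -signr_odd; case: (odd _); rewrite /= ?expr0 ?expr1; lra.
- by rewrite -card_col ler_nat max_card.
Qed.

Lemma coeff_neq0 e S : coeff e S != 0 -> [/\ S \subset e, S != set0 & ~~ odd #|S|].
Proof.
rewrite /coeff; case: ifP => [/andP[-> ->]|_]; last by rewrite eqxx.
move=> h; split=> //; apply: contra h => od.
by rewrite -signr_odd od /= expr1 subrr !mul0r.
Qed.

(** Expansion in the monomials of z: the empty set gives the count for the uniform colouring, the
    other sets give [coeff] by [sum_hit] and [sum_hit_out]. *)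
Lemma hit_weight e z : \sum_f (hit e f)%:R * weight z f =
  #|[set f | hit e f]|%:R - ncol * \sum_S coeff e S * \prod_(v in S) z v.
Proof.
rewrite sum_weight_expand (bigD1 set0) //= big_set0 mulr1.
rewrite (eq_bigr (fun f => (hit e f)%:R)); last by move=> f _; rewrite epsS0 mulr1.
congr (_ + _).
  by rewrite -natr_sum -sum1_card [in RHS]big_mkcond /=; congr (_%:R); apply: eq_bigr => f _; rewrite inE; case: ifP.
rewrite [in RHS](bigD1 set0) //= {1}/coeff eqxx andbF mul0r add0r -mulrN -sumrN mulr_sumr.
apply: eq_bigr => S S0; rewrite /coeff S0 andbT; case: ifPn => Se.
  rewrite sum_hit //; have := ncol_gt0 => np.
  by rewrite mulNr mulrN [in RHS]mulrA (mulrC (ncol)) divfK ?gt_eqF.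
by rewrite sum_hit_out // !mul0r oppr0 mulr0.
Qed.

Lemma card_extend e (g : V -> 'I_n.+2) :
  (#|[set f : {ffun V -> 'I_n.+2} | [forall v in e, f v == g v]]| * n.+2 ^ #|e| = n.+2 ^ #|V|)%N.
Proof.
have -> : #|[set f : {ffun V -> 'I_n.+2} | [forall v in e, f v == g v]]| =
    (\sum_(f : {ffun V -> 'I_n.+2}) \prod_v (if v \in e then (f v == g v : nat) else 1))%N.
  rewrite -sum1_card big_mkcond /=; apply: eq_bigr => f _; rewrite inE.
  case: ifPn => [/forall_inP h|].
    by rewrite big1 // => v _; case: ifP => // ve; rewrite h.
  rewrite negb_forall => /existsP[v]; rewrite negb_imply => /andP[ve /negPf fv].
  by rewrite (bigD1 v) //= ve fv.
rewrite -(bigA_distr_bigA (fun v i => if v \in e then (i == g v : nat) else 1%N)).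
rewrite (eq_bigr (fun v => if v \in ~: e then n.+2 else 1%N)); last first.
  move=> v _; rewrite inE; case: (v \in e) => /=; last by rewrite sum1_card card_ord.
  rewrite (bigD1 (g v)) //= eqxx big1 // => i /negPf ->//.
rewrite -big_mkcond /=.
by rewrite prod_nat_const -expnD addnC cardsC.
Qed.

(** Since e has at least n vertices outside S, one colouring of e suits: colour [col0] on S, the n
    unbiased colours on the first n vertices of e outside S, and [col0] on the rest. All its
    extensions to V are good. *)
Lemma good_lower e S : S \subset e -> (#|S| + n <= #|e|)%N ->
  (n.+2 ^ #|V| <= #|good e S| * n.+2 ^ #|e|)%N.
Proof.
move=> Se nS.
pose g v := let j := index v (enum (e :\: S)) in
  if (j < n)%N && (v \notin S) then inord j.+2 else col0 : 'I_n.+2.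
rewrite -(card_extend e g) leq_mul2r; apply/orP; right.
apply/subset_leq_card/subsetP => f; rewrite !inE => /forall_inP fg.
have inordE j : (j < n)%N -> nat_of_ord (inord j.+2 : 'I_n.+2) = j.+2.
  by move=> jn; rewrite inordK.
apply/and3P; split.
- apply/forallP => i; apply/implyP => i0; apply/implyP => i1.
  have i2 : (1 < i)%N.
    case: i i0 i1 => [[|[|i]] hi] //.
  have in_ : (i.-2 < size (enum (e :\: S)))%N.
    rewrite -cardE; have := cardsID S e; rewrite (setIidPr Se).
    by have := ltn_ord i; lia.
  have [v0 _] : exists v : V, true.
    have : (0 < size (enum (e :\: S)))%N by apply: leq_ltn_trans in_.
    by case: (enum _) => // v0 _ _; exists v0.
  pose v := nth v0 (enum (e :\: S)) i.-2.
  have : v \in enum (e :\: S) by apply: mem_nth.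
  rewrite mem_enum inE => /andP[vS ve].
  apply/existsP; exists v; rewrite ve (eqP (fg v ve)) /g vS andbT.
  rewrite index_uniq ?enum_uniq //.
  have lt : (i.-2 < n)%N by have := ltn_ord i; lia.
  by rewrite lt; apply/eqP/val_inj; rewrite /= inordE //; lia.
- apply/forall_inP => v ve; rewrite (eqP (fg v ve)) /g.
  case: ifP => // /andP[lt _]; apply/eqP => /(congr1 (@nat_of_ord _)).
  by rewrite inordE.
- apply/forall_inP => v vS; rewrite (eqP (fg v (subsetP Se v vS))) /g.
  by rewrite vS andbF.
Qed.

Lemma coeff_lower k e S : #|e| = k -> S \subset e -> S != set0 -> ~~ odd #|S| ->
  (#|S| + n <= k)%N -> (n.+2)%:R ^- k <= coeff e S.
Proof.
move=> ek Se S0 ev Sn; rewrite /coeff Se S0 /= -signr_odd (negPf ev) expr0.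
rewrite ler_pdivlMr ?ncol_gt0 // mulrC ler_pdivrMr ?exprn_gt0 ?ltr0n //.
have : ncol <= #|good e S|%:R * (n.+2)%:R ^+ k.
  rewrite /ncol -!natrX -natrM ler_nat -ek; apply: good_lower => //.
  by rewrite ek.
have : 0 <= #|good e S|%:R * (n.+2)%:R ^+ k :> R by rewrite mulr_ge0 ?exprn_ge0 ?ler0n.
rewrite -mulrA; lra.
Qed.

End Rounding.

(** * Surjections, Stirling numbers and cuts from colourings *)

Definition surj (k n : nat) : {set {ffun 'I_k -> 'I_n.+2}} :=
  [set g : {ffun 'I_k -> 'I_n.+2} | [forall i, exists j, g j == i]].

(** A partition with a numbering of its blocks defines a surjection, and distinct pairs give
    distinct surjections. This bounds the main term in the surplus by the expected cut size of a
    uniform colouring. *)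
Lemma stirling2_fact_le (k n : nat) : (stirling2 k n.+2 * (n.+2)`! <= #|surj k n|)%N.
Proof.
rewrite /stirling2 -(card_Sn n.+2) -cardsT -cardsX.
pose F (x : {set {set 'I_k}} * 'S_n.+2) : {ffun 'I_k -> 'I_n.+2} :=
  [ffun j => x.2 (inord (index (pblock x.1 j) (enum x.1)))].
set D := setX _ _.
have blk (P : {set {set 'I_k}}) : partition P [set: 'I_k] -> #|P| == n.+2 -> forall j,
    nat_of_ord (inord (index (pblock P j) (enum P)) : 'I_n.+2) = index (pblock P j) (enum P).
  move=> pP /eqP cP j; rewrite inordK // -cP cardE index_mem mem_enum pblock_mem //.
  by rewrite (cover_partition pP) inE.
have pbin (P : {set {set 'I_k}}) : partition P [set: 'I_k] -> forall j, pblock P j \in enum P.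
  by move=> pP j; rewrite mem_enum pblock_mem // (cover_partition pP) inE.
have ex (P : {set {set 'I_k}}) (i : 'I_n.+2) : partition P [set: 'I_k] -> #|P| == n.+2 ->
    exists j, inord (index (pblock P j) (enum P)) = i.
  move=> pP cP; have /and3P[_ tP n0] := pP.
  have lt : (i < size (enum P))%N by rewrite -cardE (eqP cP).
  pose B := nth set0 (enum P) i.
  have BP : B \in P by rewrite -mem_enum mem_nth.
  have [j jB] : exists j, j \in B by apply/set0Pn; apply: contraNneq n0 => <-.
  exists j; apply: val_inj => /=; rewrite blk // (def_pblock tP BP jB).
  by rewrite index_uniq // enum_uniq.
have <- : #|[set F x | x in D]| = #|D|.
  apply: card_in_imset => [[P s] [P' s']]; rewrite !inE /= !andbT.
  move=> /andP[pP cP] /andP[pP' cP'] eqF.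
  (* The fibres of the surjection recover the partition; the permutation is then recovered because
     every index belongs to a nonempty block. *)
  have fib (Q : {set {set 'I_k}}) (t : 'S_n.+2) : partition Q [set: 'I_k] -> #|Q| == n.+2 ->
      preim_partition (F (Q, t)) [set: 'I_k] = Q.
    move=> pQ cQ; rewrite -[RHS](preim_partition_pblock pQ).
    rewrite /preim_partition /equivalence_partition; apply: eq_imset => x.
    apply/setP => y; rewrite !inE /= !ffunE /= (inj_eq perm_inj) -(inj_eq val_inj) /= !blk //.
    apply/eqP/eqP => [h|-> //].
    by rewrite -(nth_index set0 (pbin _ pQ x)) h nth_index ?pbin.
  have PP : P = P' by rewrite -(fib P s) // -(fib P' s') // eqF.
  subst P'; congr pair; apply/permP => i; have [j <-] := ex P i pP cP.
  by have /ffunP/(_ j) := eqF; rewrite !ffunE.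
apply/subset_leq_card/subsetP => x /imsetP[[P s]]; rewrite !inE /= andbT.
move=> /andP[pP cP] ->; apply/forallP => i.
have [j hj] := ex P ((s^-1)%g i) pP cP.
by apply/existsP; exists j; rewrite ffunE /= hj permKV.
Qed.

(** Colourings are grouped by their restriction to e, transported to ['I_k] by an enumeration of e;
    [card_extend] counts each group. The empty edge is separate, as that enumeration requires a
    vertex of e. *)
Lemma card_hit (V : finType) (n k : nat) (e : {set V}) : #|e| = k ->
  (#|[set f : {ffun V -> 'I_n.+2} | hit e f]| * n.+2 ^ k = #|surj k n| * n.+2 ^ #|V|)%N.
Proof.
move=> ek; have [e0|[v0 v0e]] := set_0Vmem e.
  rewrite e0 in ek *.
  have -> : [set f : {ffun V -> 'I_n.+2} | hit set0 f] = set0.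
    apply/setP => f; rewrite !inE; apply/negbTE; rewrite negb_forall.
    by apply/existsP; exists ord0; apply/existsPn => v; rewrite inE.
  have k0 : k = 0%N by rewrite -ek cards0.
  rewrite k0; have -> : surj 0 n = set0; last by rewrite !cards0.
  apply/setP => g; rewrite !inE; apply/negbTE; rewrite negb_forall.
  by apply/existsP; exists ord0; apply/existsPn => -[].
pose nu (i : 'I_k) := enum_val (cast_ord (esym ek) i).
pose rk v := cast_ord ek (enum_rank_in v0e v).
have nuK i : rk (nu i) = i by apply: val_inj; rewrite /= enum_valK_in.
have rkK v : v \in e -> nu (rk v) = v.
  move=> ve; rewrite /nu /rk cast_ordK enum_rankK_in //.
have nue i : nu i \in e by apply: enum_valP.
pose G (f : {ffun V -> 'I_n.+2}) : {ffun 'I_k -> 'I_n.+2} := [ffun i => f (nu i)].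
have hG f : hit e f = (G f \in surj k n).
  rewrite inE; apply: eq_forallb => i; apply/existsP/existsP.
    by case=> v /andP[ve fv]; exists (rk v); rewrite ffunE rkK.
  by case=> j; rewrite ffunE => fj; exists (nu j); rewrite nue.
rewrite -sum1_card (partition_big G (mem (surj k n))) /=; last first.
  by move=> f; rewrite inE hG.
rewrite big_distrl /= -sum_nat_const; apply: eq_bigr => g gs.
have ce := card_extend e (fun v => g (rk v)); rewrite ek in ce.
rewrite sum1_card -ce; congr (_ * _)%N.
apply: eq_card => f; rewrite unfold_in /= !inE hG.
apply/andP/forall_inP => [[_ /eqP <-] v ve|h]; first by rewrite ffunE rkK.
have -> : G f = g by apply/ffunP => i; rewrite ffunE (eqP (h _ (nue i))) nuK.
by rewrite gs eqxx.
Qed.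

(** A single hit edge forces every colour to occur, so there are exactly n + 2 colour classes and
    none is empty. *)
Lemma cut_of_coloring (V : finType) (n : nat) (E : {set {set V}}) (f : {ffun V -> 'I_n.+2}) e :
  hit e f ->
  is_cut n.+2 (preim_partition f [set: V]) /\
  (#|[set e in E | hit e f]| <= cut_size E (preim_partition f [set: V]))%N.
Proof.
move=> /forallP he.
have surjf i : exists v, f v = i by have /existsP[v /andP[_ /eqP]] := he i; exists v.
split.
  rewrite /is_cut preim_partitionP /=.
  have -> : preim_partition f [set: V] = [set f @^-1: [set i] | i : 'I_n.+2].
    apply/setP => A; apply/imsetP/imsetP => [[x _ ->]|[i _ ->]].
      by exists (f x) => //; apply/setP => y; rewrite !inE eq_sym.
    have [v <-] := surjf i; exists v => //.
    by apply/setP => y; rewrite !inE eq_sym.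
  rewrite card_imset ?card_ord // => i j /setP eqij.
  have [v fv] := surjf i; have := eqij v; rewrite !inE fv eqxx => /esym/eqP //.
apply/subset_leq_card/subsetP => e'; rewrite !inE => /andP[-> /forallP h] /=.
apply/forall_inP => _ /imsetP[x _ ->].
have /existsP[v /andP[ve /eqP fv]] := h (f x).
by apply/set0Pn; exists v; rewrite !inE ve fv eqxx.
Qed.

(** The average number of hit edges under [weight] is at least the main term plus X, so some
    colouring reaches it. *)
Lemma rounding (R : realType) (V : finType) (n k : nat) (E : {set {set V}})
    (z : V -> R) (X : R) :
  uniform k E -> (forall v, `|z v| <= 1) -> 0 < X ->
  \sum_(e in E) \sum_S coeff R n e S * \prod_(v in S) z v <= - X ->
  exists P, is_cut n.+2 P /\ X <= surplus R k n.+2 E P.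
Proof.
move=> uE z1 X0 hX.
set N0 : R := (stirling2 k n.+2 * (n.+2)`!)%:R / n.+2%:R ^+ k * #|E|%:R.
have N00 : 0 <= N0 by rewrite !mulr_ge0 ?invr_ge0 ?exprn_ge0 ?ler0n.
have np := ncol_gt0 R V n.
have lowhit e : e \in E -> ncol R V n * ((stirling2 k n.+2 * (n.+2)`!)%:R / n.+2%:R ^+ k)
     <= #|[set f : {ffun V -> 'I_n.+2} | hit e f]|%:R.
  move=> eE; rewrite mulrA ler_pdivrMr ?exprn_gt0 ?ltr0n // /ncol -!natrX -!natrM ler_nat.
  rewrite (card_hit n (uE e eE)) mulnC leq_mul2r stirling2_fact_le orbT //.
have : ncol R V n * (N0 + X) <= \sum_(f : {ffun V -> 'I_n.+2}) #|[set e in E | hit e f]|%:R * weight z f.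
  have -> : \sum_(f : {ffun V -> 'I_n.+2}) #|[set e in E | hit e f]|%:R * weight z f =
      \sum_(e in E) \sum_(f : {ffun V -> 'I_n.+2}) (hit e f)%:R * weight z f.
    rewrite exchange_big /=; apply: eq_bigr => f _; rewrite -mulr_suml; congr (_ * _).
    rewrite -sum1_card natr_sum big_mkcond [RHS]big_mkcond /=; apply: eq_bigr => e _.
    by rewrite inE; case: (e \in E) => //=; case: (hit e f).
  under eq_bigr do rewrite hit_weight.
  rewrite sumrB -mulr_sumr mulrDr; apply: lerD; last first.
    by rewrite -mulrN; apply: ler_wpM2l; [exact: ltW | rewrite lerNr].
  rewrite /N0 mulrA mulr_natr -sumr_const; exact: ler_sum.
move=> hsum.
have [f hf] : exists f : {ffun V -> 'I_n.+2}, N0 + X <= #|[set e in E | hit e f]|%:R.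
  apply/existsP; apply: contraTT hsum => /existsPn nf; rewrite -ltNge.
  rewrite -(sum_weight n z) mulr_suml.
  have le (f : {ffun V -> 'I_n.+2}) : #|[set e in E | hit e f]|%:R * weight z f <= weight z f * (N0 + X).
    by rewrite mulrC; apply: ler_wpM2l; [exact: weight_ge0 | apply: ltW; rewrite ltNge nf].
  rewrite lt_neqAle; apply/andP; split; last by apply: ler_sum => f _; exact: le.
  (* Equality would force every weight to vanish, whereas the weights add up to [ncol] > 0. *)
  apply/negP => /eqP eqs.
  have : \sum_(f : {ffun V -> 'I_n.+2}) (weight z f * (N0 + X) - #|[set e in E | hit e f]|%:R * weight z f) = 0.
    by rewrite sumrB eqs subrr.
  move=> s0; have h0 := psumr_eq0P _ s0.
  have : \sum_(f : {ffun V -> 'I_n.+2}) weight z f = 0.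
    apply: big1 => f _.
    have : weight z f * (N0 + X) - #|[set e in E | hit e f]|%:R * weight z f = 0.
      by apply: h0 => // f' _; rewrite subr_ge0; apply: le.
    rewrite [_%:R * _]mulrC -mulrBr => /eqP; rewrite mulf_eq0 => /orP[/eqP //|].
    by rewrite subr_eq0 => /eqP e1; have := nf f; rewrite e1 lexx.
  by rewrite sum_weight => e1; rewrite e1 ltxx in np.
(* As X > 0, at least one edge is hit; it certifies that all colours are used. *)
have cnt : (0 < #|[set e in E | hit e f]|)%N.
  by rewrite -(ltr0n R); apply: lt_le_trans hf; rewrite ltr_wpDl.
have [e] := card_gt0P cnt; rewrite inE => /andP[_ he].
have [cP sP] := cut_of_coloring E he.
exists (preim_partition f [set: V]); split=> //.
rewrite /surplus -/N0 lerBrDl; apply: le_trans hf _; by rewrite ler_nat.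
Qed.

(** * Gain from a matching *)

Section Matching.
Variables (R : realFieldType) (V : finType) (k : nat) (E : {set {set V}}).
Variables (b : {set V} -> {set V} -> R) (be : R).
Implicit Types (e S Y : {set V}) (u v : V).
Hypothesis E_card : {in E, forall e, #|e| = k}.
Hypothesis b02 : {in E, forall e S, 0 <= b e S <= 2}.
Hypothesis b_neq0 : {in E, forall e S, b e S != 0 -> [/\ S \subset e, S != set0 & ~~ odd #|S|]}.
Hypothesis b_pair : {in E, forall e u v, u \in e -> v \in e -> u != v -> be <= b e [set u; v]}.
Hypotheses (be0 : 0 < be) (be1 : be <= 1) (k0 : (0 < k)%N).

Section Involution.
Variables (tau : V -> V).
Hypothesis tauK : involutive tau.

Definition matched e := [set u in e | (tau u \in e) && (tau u != u)].

Let first u := (enum_rank u < enum_rank (tau u))%N.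
(** The amplitude is so small that at most 2 ^ k terms of size 2 [kap] ^ 4 cost no more than half of
    the gain [kap] ^ 2 [be] of one matched pair. *)
Let kap : R := be / (4 * 2 ^+ k).

(** Each pair {u, tau u} shares one random sign, that of its member of smaller rank, with opposite
    values at the two ends; fixed points get 0. *)
Definition pair_point (Y : {set V}) u : R :=
  kap * ((if tau u == u then 0 else if first u then 1 else -1) *
    sgn R Y (if first u then u else tau u)).

Lemma firstN u : tau u != u -> first (tau u) = ~~ first u.
Proof.
move=> tu; rewrite /first tauK -leqNgt [RHS]leq_eqVlt.
have -> // : (enum_rank (tau u) == enum_rank u :> nat) = false.
by apply/negbTE; apply: contra tu => /eqP/val_inj/enum_rank_inj ->.
Qed.

Lemma pair_point_tau Y u : pair_point Y (tau u) = - pair_point Y u.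
Proof.
rewrite /pair_point tauK eq_sym; have [e1|tu] := eqVneq.
  by rewrite !mul0r mulr0 oppr0.
rewrite firstN // -mulrN -mulNr; congr (_ * _); case: (first u) => //=.
by rewrite opprK.
Qed.

Lemma kap_gt0 : 0 < kap.
Proof. by rewrite divr_gt0 // mulr_gt0 ?exprn_gt0. Qed.

Lemma kap_le : kap * (4 * 2 ^+ k) = be.
Proof. by rewrite divfK // gt_eqF // mulr_gt0 ?exprn_gt0. Qed.

Lemma kap_le1 : kap <= 1.
Proof.
have h : 1 <= (2 : R) ^+ k by rewrite exprn_ege1 // ler1n.
rewrite ler_pdivrMr ?mulr_gt0 ?exprn_gt0 // mul1r.
apply: le_trans be1 _; apply: le_trans h _; rewrite ler_peMl ?exprn_ge0 //.
by rewrite ler1n.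
Qed.

Lemma normr_pair_point Y u : `|pair_point Y u| <= kap.
Proof.
rewrite normrM (gtr0_norm kap_gt0) -[leRHS]mulr1 ler_pM2l ?kap_gt0 //.
rewrite normrM normr_sgn mulr1.
by case: (tau u == u); case: (first u); rewrite ?normr0 ?normrN1 ?normr1.
Qed.

Lemma pair_point_sqr Y u : tau u != u -> pair_point Y u * pair_point Y (tau u) = - kap ^+ 2.
Proof.
move=> tu; rewrite pair_point_tau mulrN; congr (- _).
rewrite /pair_point (negPf tu) -expr2 !exprMn [sgn _ _ _ ^+ 2]expr2 sgnM mulr1.
by case: (first u); rewrite ?sqrrN expr1n mulr1.
Qed.

Lemma pair_point_flip Y u v :
  pair_point (flip (if first v then v else tau v) Y) u =
  if (u == v) || (u == tau v) then - pair_point Y u else pair_point Y u.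
Proof.
rewrite /pair_point sgn_flip.
have [tu|tu] := eqVneq (tau u) u; first by rewrite !mul0r !mulr0 oppr0; case: ifP.
have -> : ((if first u then u else tau u) == (if first v then v else tau v)) =
          ((u == v) || (u == tau v)).
  have [->|uv] := eqVneq u v; first by rewrite eqxx.
  have [eu|utv] /= := eqVneq u (tau v).
    subst u; rewrite tauK firstN ?tauK; last by rewrite tauK in tu; rewrite eq_sym.
    by case: (first v); rewrite eqxx.
  have tuv : tau u != v by apply: contra utv => /eqP <-; rewrite tauK.
  have tutv : tau u != tau v by rewrite (inj_eq (inv_inj tauK)).
  by case: (first u); case: (first v); apply/negbTE.
by case: ((u == v) || _); rewrite // !mulrN.
Qed.

(** A fixed point contributes the factor 0; otherwise flipping the sign of the pair of v negates the
    factor of v and no other factor over S. *)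
Lemma Ex_pair_open S v : v \in S -> (tau v \notin S) || (tau v == v) ->
  Ex (fun Y => \prod_(u in S) pair_point Y u) = 0.
Proof.
move=> vS; have [tv _|tv /=] := eqVneq (tau v) v.
  rewrite (eq_Ex (g := fun=> 0)) ?Ex_const // => Y.
  by rewrite (bigD1 v) //= {1}/pair_point tv eqxx mul0r mulr0 mul0r.
rewrite orbF => tvS; apply: (@Ex_odd _ _ (if first v then v else tau v)) => Y.
rewrite !(bigD1 v vS) /= pair_point_flip eqxx mulNr; congr (- (_ * _)).
apply: eq_bigr => u /andP[uS /negPf uv]; rewrite pair_point_flip uv /=.
by have [eu|//] := eqVneq u (tau v); rewrite -eu (_ : u \in S) in tvS.
Qed.

(** A two-element set contributes 0 or, when it is a matched pair, a nonpositive amount. By parity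
    the remaining sets have at least four elements. *)
Lemma pair_term e S : e \in E -> b e S * Ex (fun Y => \prod_(u in S) pair_point Y u) <=
  if (S \subset e) && (2 < #|S|)%N then 2 * kap ^+ 4 else 0.
Proof.
move=> eE; have kp := kap_gt0; have /andP[b0 b2] := b02 eE S.
have rhs0 : 0 <= (if (S \subset e) && (2 < #|S|)%N then 2 * kap ^+ 4 else 0).
  by case: ifP => // _; rewrite mulr_ge0 // exprn_ge0 // ltW.
have [->|/(b_neq0 eE)[Se S0 ev]] := eqVneq (b e S) 0; first by rewrite mul0r.
rewrite Se /= in rhs0 *; have [S3|S2] := ltnP 2 #|S|.
  have S4 : (3 < #|S|)%N by rewrite ltn_neqAle S3 andbT; apply: contraNneq ev => <-.
  apply: le_trans (_ : b e S * kap ^+ 4 <= _); last by rewrite ler_wpM2r // exprn_ge0 // ltW.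
  apply: ler_wpM2l => //; apply: le_trans (ler_norm _) _; apply: le_trans (Ex_norm _) _.
  rewrite -[leRHS](Ex_const V); apply: Ex_le => Y; rewrite normr_prod.
  apply: (@le_trans _ _ (\prod_(u in S) kap)).
    by apply: ler_prod => u _; rewrite normr_ge0 normr_pair_point.
  by rewrite prodr_const ler_wiXn2l ?kap_le1 // ltW.
have [v vS] := set0Pn _ S0.
have [op|] := boolP ((tau v \notin S) || (tau v == v)).
  by rewrite (Ex_pair_open vS op) mulr0.
rewrite negb_or negbK => /andP[tvS tv].
rewrite (eq_Ex (g := fun=> - kap ^+ 2)).
  by rewrite Ex_const mulrN oppr_le0 mulr_ge0 // exprn_ge0 // ltW.
move=> Y; rewrite (bigD1 v) //= (bigD1 (tau v)) /= ?tvS ?tv // big1; last first.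
  move=> u /andP[/andP[uS uv] utv].
  have : (3 <= #|S|)%N.
    rewrite (cardsD1 v) vS (cardsD1 (tau v)) !inE tvS tv /= (cardsD1 u).
    by rewrite !inE uS uv utv.
  by rewrite leqNgt ltnS S2.
by rewrite mulr1 pair_point_sqr.
Qed.

(** One matched pair inside e pays for all the larger sets. Since e has at most k matched vertices,
    its gain is spread over them at the cost of a factor k. Without matched vertices every term is
    0. *)
Lemma pair_edge e : e \in E ->
  \sum_S b e S * Ex (fun Y => \prod_(u in S) pair_point Y u) <=
  - (kap ^+ 2 * be / (2 * k%:R) * #|matched e|%:R).
Proof.
move=> eE; have kp := kap_gt0; have [m0|[u]] := set_0Vmem (matched e).
  rewrite m0 cards0 mulr0 oppr0 big1 // => S _.
  have [->|/(b_neq0 eE)[Se S0 _]] := eqVneq (b e S) 0; first by rewrite mul0r.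
  have [v vS] := set0Pn _ S0; rewrite (Ex_pair_open vS) ?mulr0 //.
  have := in_set0 v; rewrite -m0 inE (subsetP Se) //= => /negbT.
  rewrite negb_and negbK => /orP[h|->]; last by rewrite orbT.
  by apply/orP; left; apply: contra h => /(subsetP Se).
rewrite inE => /and3P[ue tue tu].
have kR : (0 : R) < k%:R by rewrite ltr0n.
have mk : #|matched e|%:R <= k%:R :> R.
  by rewrite ler_nat -(E_card eE) subset_leq_card //; apply/subsetP => v; rewrite inE => /andP[].
apply: (@le_trans _ _ (- (kap ^+ 2 * be / 2))); last first.
  rewrite lerN2 -[leRHS]mulr1 invfM !mulrA -[leLHS]mulrA.
  apply: ler_wpM2l; last by rewrite mulrC ler_pdivrMr // mul1r.
  by rewrite divr_ge0 // mulr_ge0 ?exprn_ge0 ?(ltW kp) ?(ltW be0).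
rewrite (bigD1 [set u; tau u]) //=.
have -> : Ex (fun Y => \prod_(u0 in [set u; tau u]) pair_point Y u0) = - kap ^+ 2.
  rewrite (eq_Ex (g := fun=> - kap ^+ 2)) ?Ex_const // => Y.
  by rewrite big_setU1 ?inE 1?eq_sym //= big_set1 pair_point_sqr.
have h1 : b e [set u; tau u] * - kap ^+ 2 <= - (be * kap ^+ 2).
  by rewrite mulrN lerN2 ler_wpM2r ?exprn_ge0 ?(ltW kp) // b_pair // eq_sym.
have h2 : \sum_(S | S != [set u; tau u]) b e S * Ex (fun Y => \prod_(v in S) pair_point Y v)
    <= 2 ^+ k * (2 * kap ^+ 4).
  apply: (@le_trans _ _ (\sum_(S : {set V} | S \subset e) 2 * kap ^+ 4)); last first.
    rewrite sumr_const -[_ *+ _]mulr_natl -natrX.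
    have -> : #|[pred S : {set V} | S \subset e]| = (2 ^ k)%N.
      by rewrite -(E_card eE) -card_powerset; apply: eq_card => A; rewrite !inE.
    by [].
  rewrite big_mkcond [leRHS]big_mkcond /=; apply: ler_sum => S _.
  have n0 : 0 <= 2 * kap ^+ 4 by rewrite mulr_ge0 // exprn_ge0 // ltW.
  case: ifP => _; last by case: ifP.
  apply: le_trans (pair_term S eE) _; case: (S \subset e) => //=.
  by case: ifP.
have h3 : 2 ^+ k * (2 * kap ^+ 4) <= kap ^+ 2 * be / 2.
  have kk : kap ^+ 2 <= kap.
    by rewrite expr2 ger_pMr // kap_le1.
  have p2 : (0 : R) < 2 ^+ k by rewrite exprn_gt0.
  have -> : 2 ^+ k * (2 * kap ^+ 4) = kap ^+ 2 * (kap ^+ 2 * (4 * 2 ^+ k)) / 2 by field.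
  apply: ler_wpM2r; first by rewrite invr_ge0.
  apply: ler_wpM2l; first by rewrite exprn_ge0 // ltW.
  by rewrite -kap_le; apply: ler_wpM2r => //; rewrite mulr_ge0 // ltW.
lra.
Qed.

Lemma matching_gain : exists z : V -> R, (forall v, `|z v| <= 1) /\
  \sum_(e in E) \sum_S b e S * \prod_(v in S) z v <=
  - (kap ^+ 2 * be / (2 * k%:R) * (\sum_(e in E) #|matched e|)%:R).
Proof.
suff h : Ex (fun Y => \sum_(e in E) \sum_S b e S * \prod_(v in S) pair_point Y v) <=
    - (kap ^+ 2 * be / (2 * k%:R) * (\sum_(e in E) #|matched e|)%:R).
  have [Y hY] := Ex_exists h.
  exists (pair_point Y); split=> // v.
  by apply: le_trans (normr_pair_point _ _) kap_le1.
rewrite Ex_sum natr_sum mulr_sumr -sumrN; apply: ler_sum => e eE.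
rewrite Ex_sum; under eq_bigr do rewrite ExZ.
exact: pair_edge.
Qed.

End Involution.
End Matching.

(** * Degeneracy *)

Section Degeneracy.
Variables (V : finType) (E : {set {set V}}) (D : nat).
Implicit Types (e S U : {set V}) (u v : V).
Hypothesis matching_le : forall tau : V -> V, involutive tau ->
  (\sum_(e in E) #|matched tau e| <= D)%N.

Definition codeg u v := #|[set e in E | (u \in e) && (v \in e)]|.

(** Identify U with the integers modulo |U| and take the reflections u -> i - u: each ordered pair
    in U is matched by exactly one i. The shape [#|U|.-1.+1] gives the ordinals their additive
    group. *)
Lemma matchings_of_complete_graph U : U != set0 -> exists tau : 'I_#|U|.-1.+1 -> V -> V,
  (forall i, involutive (tau i)) /\
  (forall (F : V -> nat) u, u \in U -> \sum_i F (tau i u) = \sum_(v in U) F v)%N.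
Proof.
case/set0Pn => u0 u0U.
have cU : #|U| = #|U|.-1.+1 by rewrite prednK //; apply/card_gt0P; exists u0.
move: (#|U|.-1) cU => n cU.
pose f (i : 'I_n.+1) := enum_val (cast_ord (esym cU) i).
pose g v := cast_ord cU (enum_rank_in u0U v).
have fK i : g (f i) = i by apply: val_inj; rewrite /= enum_valK_in.
have gK v : v \in U -> f (g v) = v by move=> vU; rewrite /f /g cast_ordK enum_rankK_in.
have fU i : f i \in U by apply: enum_valP.
exists (fun i u => if u \in U then f (i - g u)%R else u); split.
  move=> i u; have [uU|/negPf uU] := boolP (u \in U); last by rewrite uU.
  by rewrite fU fK subKr gK.
move=> F u uU; rewrite uU.
rewrite (reindex_inj (h := fun i => (i + g u)%R)) /=; last exact: addIr.
rewrite (eq_bigr (fun i => F (f i))); last by move=> i _; rewrite addrK.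
rewrite [RHS](reindex_onto f g) /=; last by move=> v vU; rewrite gK.
by apply: eq_bigl => i; rewrite fU fK eqxx.
Qed.

(** Split the pairs of U among the |U| reflections; each of them matches at most D vertices, counted
    over all edges. *)
Lemma sum_codeg_le U :
  (\sum_(u in U) \sum_(v in U | v != u) codeg u v <= #|U| * D)%N.
Proof.
have [->|U0] := eqVneq U set0; first by rewrite big_set0.
have [tau [tauK tauE]] := matchings_of_complete_graph U0.
have cU : #|U| = #|U|.-1.+1 by rewrite prednK // card_gt0.
apply: (@leq_trans (\sum_(i < #|U|.-1.+1) \sum_(e in E) #|matched (tau i) e|)); last first.
  rewrite [X in (_ <= X * _)%N]cU -[X in (_ <= X * _)%N]card_ord -sum_nat_const.
  by apply: leq_sum => i _; apply: matching_le; apply: tauK.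
rewrite exchange_big /=.
have -> : (\sum_(u in U) \sum_(v in U | v != u) codeg u v =
   \sum_(e in E) \sum_(u in U) \sum_(v in U) ((u \in e) && (v \in e) && (v != u)))%N.
  rewrite [RHS]exchange_big /=; apply: eq_bigr => u _.
  rewrite [RHS]exchange_big /= big_mkcondr /=; apply: eq_bigr => v _.
  rewrite /codeg -sum1_card big_mkcond [in RHS]big_mkcond /=.
  case: (v != u); last by rewrite big1 // => e _; rewrite andbF if_same.
  by apply: eq_bigr => e _; rewrite inE; case: (e \in E); case: (u \in e); case: (v \in e).
apply: leq_sum => e _.
apply: (@leq_trans (\sum_(i < #|U|.-1.+1) \sum_(u in U) ((u \in e) && (tau i u \in e) && (tau i u != u)))).
  rewrite [leqRHS]exchange_big /=; apply: leq_sum => u uU.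
  by rewrite (tauE (fun v => (u \in e) && (v \in e) && (v != u) : nat) u uU).
apply: leq_sum => i _; rewrite -sum1_card big_mkcond [leqRHS]big_mkcond /=.
apply: leq_sum => u _; rewrite inE andbA; case: (u \in U) => //=.
Qed.

(** By [sum_codeg_le] some vertex of U has total codegree at most D to the rest of U. It is placed
    last, and the induction continues on the other vertices. *)
Lemma degeneracy_order : exists rank : V -> nat, injective rank /\
  forall v, (\sum_(u | (rank u < rank v)%N) codeg u v <= D)%N.
Proof.
suff h n : forall U, #|U| = n -> exists rank : V -> nat,
    [/\ {in U, forall u, (rank u < n)%N}, {in U &, injective rank} &
     {in U, forall v, \sum_(u in U | (rank u < rank v)%N) codeg u v <= D}%N].
  have [rank [_ inj le]] := h _ [set: V] erefl.
  exists rank; split=> [u v|v]; first by apply: inj; rewrite inE.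
  have := le v (in_setT v); apply: leq_trans; rewrite leq_eqVlt; apply/orP; left.
  by apply/eqP; apply: eq_bigl => u; rewrite inE.
elim: n => [|n IH] U cU.
  exists (fun=> 0%N); have U0 := cards0_eq cU; rewrite U0.
  by split=> [u|u v|u]; rewrite inE.
have [v vU vle] : exists2 v, v \in U & (\sum_(u in U | u != v) codeg u v <= D)%N.
  apply/exists_inP; apply: contraT; rewrite negb_exists_in => /forall_inP nv.
  have : (\sum_(u in U) D.+1 <= \sum_(u in U) \sum_(v in U | v != u) codeg u v)%N.
    apply: leq_sum => u uU; have := nv u uU; rewrite -ltnNge => h.
    apply: leq_trans h _; rewrite leq_eqVlt; apply/orP; left; apply/eqP.
    apply: eq_bigr => w _; congr #|pred_of_set _|; apply/setP => e.
    by rewrite !inE [(w \in e) && _]andbC.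
  move/leq_trans => /(_ _ (sum_codeg_le U)).
  by rewrite sum_nat_const leq_mul2l cU /= ltnn.
have cUv : #|U :\ v| = n by have := cardsD1 v U; rewrite vU cU => -[].
have [rank [lt inj le]] := IH _ cUv.
exists (fun u => if u == v then n else rank u); split.
- move=> u uU; have [//|uv] := eqVneq u v.
  by apply: ltnW; rewrite ltnS; apply: lt; rewrite !inE uv.
- move=> u w uU wU; have [->|uv] := eqVneq u v; have [->|wv] := eqVneq w v => //.
  + by move=> e1; have := lt w; rewrite !inE wv wU -e1 ltnn => /(_ isT).
  + by move=> e1; have := lt u; rewrite !inE uv uU e1 ltnn => /(_ isT).
  + by apply: inj; rewrite !inE ?uv ?wv.
- move=> w wU; have [->|wv] := eqVneq w v.
    apply: leq_trans vle; rewrite big_mkcond [leqRHS]big_mkcond /=.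
    by apply: leq_sum => u _; case: (u \in U); case: (eqVneq u v) => //=; rewrite ?ltnn //; case: ifP.
  have wUv : w \in U :\ v by rewrite !inE wv.
  apply: leq_trans (le w wUv); rewrite big_mkcond [leqRHS]big_mkcond /=.
  apply: leq_sum => u _; rewrite !inE; case: (eqVneq u v) => //= _.
  have -> : (n < rank w)%N = false by apply/negbTE; rewrite -leqNgt ltnW // lt.
  by rewrite andbF.
Qed.

(** Take the last vertex v of each S. An edge containing S also contains v and an earlier vertex of
    S, so it is counted by the codegrees from v to its predecessors; one edge accounts for at most 2
    ^ k sets S. *)
Lemma designated_vertex (v0 : V) (rank : V -> nat) (T : {set {set V}}) k :
  injective rank ->
  (forall v, \sum_(u | (rank u < rank v)%N) codeg u v <= D)%N ->
  {in E, forall e, #|e| = k} ->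
  {in T, forall S, (1 < #|S|)%N} ->
  {in T, forall S, exists2 e, e \in E & S \subset e} ->
  exists des : {set V} -> V, {in T, forall S, des S \in S} /\
    (forall v, #|desfam T des v| <= 2 ^ k * D)%N.
Proof.
move=> inj le Ek T1 TE.
(* The default [v0] only makes the definition total: the members of T are nonempty. *)
pose des S := [arg max_(v > odflt v0 [pick v in S] in S) rank v].
have desP S : S \in T -> des S \in S /\ forall u, u \in S -> u != des S -> (rank u < rank (des S))%N.
  move=> ST; rewrite /des; case: pickP => [u uS|S0] /=; last first.
    have := T1 S ST; rewrite (eq_card0 S0) //.
  case: arg_maxnP => // v vS vmax; split=> // w wS wv.
  rewrite ltn_neqAle; apply/andP; split; last exact: vmax.
  by rewrite (inj_eq inj).
exists des; split=> [S /desP[] //|v].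
apply: leq_trans (_ : (\sum_(S in desfam T des v) \sum_(e in E) (S \subset e) <= _)%N).
  rewrite -sum1_card; apply: leq_sum => S; rewrite inE => /andP[ST _].
  have [e eE Se] := TE S ST.
  by rewrite (bigD1 e) //= Se.
rewrite exchange_big /=.
apply: leq_trans (_ : (\sum_(e in E) \sum_(u | (rank u < rank v)%N) 2 ^ k * ((u \in e) && (v \in e)) <= _)%N).
  apply: leq_sum => e eE.
  have [no|[S]] := set_0Vmem [set S in desfam T des v | S \subset e].
    rewrite big1 // => S SD; have := in_set0 S; rewrite -no inE SD /=.
    by case: (S \subset e).
  rewrite !inE => /andP[/andP[ST /eqP dS] Se].
  have [dSS dmax] := desP S ST; rewrite dS in dSS dmax.
  have [u] : exists u, u \in S :\ v.
    by apply/set0Pn; rewrite -card_gt0; have := cardsD1 v S; have := T1 S ST; rewrite dSS; lia.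
  rewrite !inE => /andP[uv uS].
  rewrite [leqRHS](bigD1 u) /=; last exact: dmax.
  rewrite (subsetP Se u uS) (subsetP Se v dSS) muln1.
  apply: leq_trans (leq_addr _ _); rewrite -(Ek e eE) -card_powerset -sum1_card.
  rewrite big_mkcond [leqRHS]big_mkcond /=; apply: leq_sum => S' _.
  by rewrite !inE; case: ifP; case: (S' \subset e).
rewrite exchange_big /=.
apply: leq_trans (leq_mul (leqnn (2 ^ k)) (le v)).
rewrite big_distrr /=; apply: leq_sum => u _; rewrite -big_distrr /= leq_mul2l.
apply/orP; right; rewrite /codeg -sum1_card big_mkcond [leqRHS]big_mkcond /=.
by apply: leq_sum => e _; rewrite inE; case: (e \in E); case: (u \in e); case: (v \in e).
Qed.

End Degeneracy.

(** * A sparse family of heavy sets *)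

Lemma subset_of_card (V : finType) (A : {set V}) (n : nat) : (n <= #|A|)%N ->
  exists2 B : {set V}, B \subset A & #|B| = n.
Proof.
move=> nA; exists [set x in take n (enum A)].
  by apply/subsetP => x; rewrite inE => /mem_take; rewrite mem_enum.
rewrite cardsE (card_uniqP _) ?take_uniq ?enum_uniq // size_takel // -cardE //.
Qed.

Section Family.
Variables (R : realFieldType) (V : finType) (E : {set {set V}}) (k Q J : nat) (mu : R).
Implicit Types (e S A : {set V}).
Hypothesis E_card : {in E, forall e, #|e| = k}.
Hypotheses (E_gt0 : (0 < #|E|)%N) (Q_gt0 : (0 < Q)%N) (J_gt0 : (0 < J)%N).
Hypotheses (mu_ge0 : 0 <= mu) (mu_ge : #|E|%:R <= mu ^+ Q).

(** The factor 2 makes all sizes even, so that [coeff] does not vanish for parity; the ratio J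
    provides s = J l for consecutive levels. *)
Definition level p := (2 * J ^ p)%N.
Hypothesis level_le : (level Q <= k)%N.

Definition deg S := #|[set e in E | S \subset e]|.
Definition maxdeg p e := (\max_(S : {set V} | (S \subset e) && (#|S| == level p)) deg S)%N.

Lemma level_mono p q : (p <= q)%N -> (level p <= level q)%N.
Proof. by move=> pq; rewrite leq_mul2l leq_pexp2l. Qed.

Lemma deg_gt0 e S : e \in E -> S \subset e -> (0 < deg S)%N.
Proof. by move=> eE Se; apply/card_gt0P; exists e; rewrite inE eE. Qed.

Lemma maxdeg_attained p e : e \in E -> (p <= Q)%N ->
  exists S, [/\ S \subset e, #|S| = level p & maxdeg p e = deg S].
Proof.
move=> eE pQ.
have [|B Be cB] := @subset_of_card _ e (level p).
  by rewrite (E_card eE); apply: leq_trans level_le; apply: level_mono.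
have h : (0 < #|[pred S : {set V} | (S \subset e) && (#|S| == level p)]|)%N.
  by apply/card_gt0P; exists B; rewrite inE Be cB eqxx.
have [S hS eS] := eq_bigmax_cond deg h.
by move: hS; rewrite inE => /andP[Se /eqP cS]; exists S.
Qed.

Definition flat p e := (maxdeg p e)%:R <= mu * (maxdeg p.+1 e)%:R :> R.


(** Otherwise the maximal degree drops by a factor above [mu] at each of Q steps, from at most |E|
    to at least 1, contradicting |E| <= [mu] ^ Q. *)
Lemma flat_level e : e \in E -> [exists p : 'I_Q, flat p e].
Proof.
move=> eE; apply: contraT; rewrite negb_exists => /forallP nf.
have h p : (p <= Q)%N -> (0 < p)%N -> mu ^+ p * (maxdeg p e)%:R < (maxdeg 0 e)%:R.
  elim: p => // p IH pQ _.
  have := nf (Ordinal pQ); rewrite /flat /= -ltNge => lt.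
  have [p0|p0] := posnP p; first by rewrite p0 in lt *; rewrite expr1.
  apply: le_lt_trans (IH (ltnW pQ) p0).
  by rewrite exprSr -mulrA; apply: ler_wpM2l; [exact: exprn_ge0 | exact: ltW].
have := h Q (leqnn Q) Q_gt0.
have [S0 [S0e _ ->]] := maxdeg_attained eE (leq0n Q).
have [SQ [SQe _ ->]] := maxdeg_attained eE (leqnn Q).
rewrite ltNge => /negP; case.
apply: (@le_trans _ _ #|E|%:R).
  by rewrite ler_nat subset_leq_card //; apply/subsetP => x; rewrite inE => /andP[].
apply: le_trans mu_ge _; rewrite ler_peMr ?exprn_ge0 // ler1n.
exact: deg_gt0 SQe.
Qed.

Lemma popular_level : exists p : 'I_Q, (#|E| <= Q * #|[set e in E | flat p e]|)%N.
Proof.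
apply/existsP; apply: contraT; rewrite negb_exists => /forallP h.
have : (Q * #|E| < Q * #|E|)%N; last by rewrite ltnn.
apply: leq_trans (_ : (Q * (\sum_(p < Q) #|[set e in E | flat p e]|).+1 <= _)%N).
  rewrite ltn_mul2l Q_gt0 /= ltnS -sum1_card.
  apply: leq_trans (_ : (\sum_(e in E) \sum_(p < Q) flat p e <= _)%N).
    apply: leq_sum => e eE; have /existsP[p fp] := flat_level eE.
    by rewrite (bigD1 p) //= fp.
  rewrite exchange_big /=; apply: leq_sum => p _; rewrite -sum1_card.
  rewrite big_mkcond [leqRHS]big_mkcond /=; apply: leq_sum => e _.
  by rewrite inE; case: (e \in E) => //=; case: (flat p e).
rewrite mulnS big_distrr /=.
have : (\sum_(p < Q) (Q * #|[set e in E | flat p e]|).+1 <= \sum_(p < Q) #|E|)%N.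
  by apply: leq_sum => p _; have := h p; rewrite -ltnNge.
have cst c : (\sum_(p < Q) c = Q * c)%N by rewrite big_const_ord iter_addn_0 mulnC.
rewrite cst; apply: leq_trans.
under [leqRHS]eq_bigr do rewrite -addn1.
by rewrite big_split /= cst muln1 addnC.
Qed.

Lemma sum_deg_above A : (\sum_(S : {set V} | A \subset S) deg S <= 2 ^ k * deg A)%N.
Proof.
have -> : (\sum_(S : {set V} | A \subset S) deg S =
    \sum_(e in E) \sum_(S : {set V} | A \subset S) (S \subset e))%N.
  rewrite exchange_big /=; apply: eq_bigr => S _; rewrite /deg -sum1_card.
  rewrite big_mkcond [RHS]big_mkcond /=; apply: eq_bigr => e _; rewrite inE.
  by case: (e \in E) => //=; case: (S \subset e).
rewrite mulnC /deg -sum_nat_const big_mkcond [leqRHS]big_mkcond /=.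
apply: leq_sum => e _; rewrite inE; case: ifPn => //= eE.
have [Ae|Ae] := boolP (A \subset e); last first.
  rewrite big1 // => S AS; apply/eqP; rewrite eqb0.
  by apply: contra Ae; apply: subset_trans.
rewrite -(E_card eE) -card_powerset -sum1_card big_mkcond [leqRHS]big_mkcond /=.
by apply: leq_sum => S _; rewrite inE; case: ifP; case: (S \subset e).
Qed.

(** At the popular level take a maximal family T of heavy sets with small pairwise intersections. By
    maximality every heavy set has a large intersection with a member of T, and flatness bounds the
    total degree of the heavy sets charged to one member. *)
Lemma sparse_family : exists p, (p < Q)%N /\ exists T : {set {set V}},
  [/\ {in T, forall S, #|S| = level p.+1},
      {in T &, forall S1 S2, S1 != S2 -> (#|S1 :&: S2| < level p)%N},
      {in T, forall S, exists2 e, e \in E & S \subset e} &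
      #|E|%:R <= Q%:R * 4 ^+ k * mu * (\sum_(S in T) deg S)%:R].
Proof.
have [p hp] := popular_level; exists p; split=> //.
set Ep := [set e in E | flat p e] in hp.
pose T0 := [set S : {set V} | (#|S| == level p.+1) &&
  [exists e in Ep, (S \subset e) && (deg S == maxdeg p.+1 e)]].
pose indep (T : {set {set V}}) := (T \subset T0) &&
  [forall S1 in T, forall S2 in T, (S1 != S2) ==> (#|S1 :&: S2| < level p)%N].
have [|T /maxsetP[/andP[TT0 Tind] Tmax]] := @ex_maxset _ indep.
  by exists set0; rewrite /indep sub0set; apply/forall_inP => S; rewrite inE.
have Tint : {in T &, forall S1 S2, S1 != S2 -> (#|S1 :&: S2| < level p)%N}.
  move=> S1 S2 S1T S2T ne.
  by have /forall_inP/(_ S1 S1T)/forall_inP/(_ S2 S2T)/implyP/(_ ne) := Tind.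
have T0P S : S \in T0 -> #|S| = level p.+1 /\
    exists e, [/\ e \in E, flat p e, S \subset e & deg S = maxdeg p.+1 e].
  rewrite inE => /andP[/eqP cS /existsP[e /andP[eEp /andP[Se /eqP dS]]]].
  by move: eEp; rewrite inE => /andP[eE fe]; split=> //; exists e.
exists T; split=> //.
- by move=> S /(subsetP TT0) /T0P[].
- by move=> S /(subsetP TT0) /T0P[_ [e [eE _ Se _]]]; exists e.
have lpp : (level p <= level p.+1)%N by apply: level_mono.
have lpk : (level p.+1 <= k)%N by apply: leq_trans level_le; apply: level_mono.
have near_T S' : S' \in T0 -> exists2 S, S \in T & (level p <= #|S :&: S'|)%N.
  move=> S'0; apply/exists_inP; apply: contraT; rewrite negb_exists_in => /forall_inP far.
  have ind : indep (S' |: T).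
    apply/andP; split; first by rewrite subUset sub1set S'0.
    apply/forall_inP => S1 S1T; apply/forall_inP => S2 S2T; apply/implyP => ne.
    move: S1T S2T; rewrite !inE => /predU1P[e1|S1T] /predU1P[e2|S2T].
    - by rewrite e1 e2 eqxx in ne.
    - by rewrite e1 setIC ltnNge far.
    - by rewrite e2 ltnNge far.
    - exact: Tint.
  have S'T : S' \in T by rewrite -(Tmax _ ind (subsetU1 _ _)) setU11.
  by have := far S' S'T; rewrite setIid (T0P S' S'0).1 lpp.
(* Every flat edge contains a set of [T0], namely one attaining the maximal degree. *)
have cover_bound : (#|Ep| <= \sum_(S in T0) deg S)%N.
  rewrite -sum1_card; apply: leq_trans (_ : (\sum_(e in Ep) \sum_(S in T0) (S \subset e) <= _)%N).
    apply: leq_sum => e eEp; have := eEp; rewrite inE => /andP[eE fe].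
    have [S [Se cS dS]] := maxdeg_attained eE (ltn_ord p).
    rewrite (bigD1 S) /= ?Se // inE cS eqxx /=; apply/existsP; exists e.
    by rewrite eEp Se dS eqxx.
  rewrite exchange_big /=; apply: leq_sum => S _; rewrite /deg -sum1_card.
  rewrite big_mkcond [leqRHS]big_mkcond /=; apply: leq_sum => e _; rewrite !inE.
  by case: (e \in E) => //=; case: (flat p e) => //=; case: (S \subset e).
(* Such an S' contains one of the at most 2 ^ k subsets A of S of size [level p]. The sets above A
   have total degree at most 2 ^ k [deg A], and [deg A] <= [mu] [deg S] as S is heaviest in a flat
   edge. *)
have local S : S \in T -> (\sum_(S' in T0 | (level p <= #|S :&: S'|)%N) deg S')%:R
    <= 4 ^+ k * mu * (deg S)%:R.
  move=> /(subsetP TT0) /T0P[cS [e [eE fe Se dS]]].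
  apply: (@le_trans _ _ (\sum_(A : {set V} | (A \subset S) && (#|A| == level p)) (2 ^ k * deg A))%:R).
    rewrite ler_nat; apply: leq_trans (_ : (\sum_(A : {set V} | (A \subset S) && (#|A| == level p))
       \sum_(S' : {set V} | A \subset S') deg S' <= _)%N); last first.
      by apply: leq_sum => A _; apply: sum_deg_above.
    rewrite [leqRHS](exchange_big_dep predT) //= big_mkcond /=; apply: leq_sum => S' _.
    case: ifP => // /andP[_ big].
    have [A AS cA] := subset_of_card big.
    move: AS; rewrite subsetI => /andP[AS AS'].
    by rewrite (bigD1 A) /= ?AS ?AS' ?cA ?eqxx // leq_addr.
  rewrite natr_sum; apply: (@le_trans _ _ (\sum_(A : {set V} | A \subset S) (2 ^+ k * (mu * (deg S)%:R)))).
    rewrite big_mkcond [leRHS]big_mkcond /=; apply: ler_sum => A _.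
    case: ifPn => [/andP[AS cA]|_]; last first.
      by case: ifP => // _; rewrite !mulr_ge0 ?exprn_ge0 ?ler0n.
    rewrite AS natrM natrX; apply: ler_wpM2l; first by rewrite exprn_ge0.
    rewrite dS; apply: le_trans fe; rewrite ler_nat.
    by rewrite /maxdeg (bigD1 A) /= ?leq_maxl // cA (subset_trans AS Se).
  rewrite sumr_const.
  have -> : #|[pred A : {set V} | A \subset S]| = (2 ^ level p.+1)%N.
    by rewrite -cS -card_powerset; apply: eq_card => A; rewrite !inE.
  rewrite -[_ *+ _]mulr_natl natrX.
  have -> : 4 ^+ k * mu * (deg S)%:R = 2 ^+ k * (2 ^+ k * (mu * (deg S)%:R)).
    have -> : (4 : R) ^+ k = 2 ^+ k * 2 ^+ k by rewrite -exprMn -natrM.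
    by ring.
  apply: ler_wpM2r; first by rewrite !mulr_ge0 ?exprn_ge0 ?ler0n.
  by apply: ler_weXn2l => //; rewrite ler1n.
apply: (@le_trans _ _ (Q%:R * (\sum_(S in T0) deg S)%:R)).
  by rewrite -natrM ler_nat; apply: leq_trans hp _; rewrite leq_mul2l cover_bound orbT.
rewrite -!mulrA; apply: ler_wpM2l; first exact: ler0n.
rewrite mulrA.
apply: (@le_trans _ _ (\sum_(S in T) (\sum_(S' in T0 | (level p <= #|S :&: S'|)%N) deg S')%:R)); last first.
  by rewrite [in leRHS]natr_sum mulr_sumr; apply: ler_sum => S; apply: local.
rewrite -!natr_sum ler_nat (exchange_big_dep (mem T0)) /=; last by move=> S S' _ /andP[].
apply: leq_sum => S' S'0; have [S ST bS] := near_T S' S'0.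
by rewrite (bigD1 S) ?ST ?S'0 //= leq_addr.
Qed.


End Family.

(** * Assembling the estimates *)

Section Gain.
Variables (R : realFieldType).

(* Here a = mu ^ Q1, so that m = a ^ 3, theta = t / (mu ^ 2 * a) and
   (a ^ 6 * mu ^ 2)^-1 is the error of the terms of degree above J = 3 * Q1. *)
Lemma gain_arith (mu a t c C : R) : 1 <= mu -> mu <= a -> 0 < t -> t <= 1 -> 0 < c -> 0 <= C ->
  4 * C <= c * t * mu ->
  a ^+ 3 * (C * ((t / (mu ^+ 2 * a)) ^+ 2 + (a ^+ 6 * mu ^+ 2)^-1)) <= c * t / 2 * (a ^+ 2 / mu ^+ 3).
Proof.
move=> mu1 mua t0 t1 c0 C0 h.
have mu0 : 0 < mu by lra.
have a0 : 0 < a by lra.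
have a1 : 1 <= a by lra.
have -> : a ^+ 3 * (C * ((t / (mu ^+ 2 * a)) ^+ 2 + (a ^+ 6 * mu ^+ 2)^-1)) =
    (4 * C * (t ^+ 2 * a ^+ 4 + mu ^+ 2)) / (4 * mu ^+ 4 * a ^+ 3).
  by field; rewrite !gt_eqF.
have -> : c * t / 2 * (a ^+ 2 / mu ^+ 3) = (2 * (c * t * mu) * a ^+ 5) / (4 * mu ^+ 4 * a ^+ 3).
  by field; rewrite !gt_eqF.
apply: ler_wpM2r; first by rewrite invr_ge0 !mulr_ge0 ?exprn_ge0 ?ltW.
have x0 : 0 <= c * t * mu by rewrite !mulr_ge0 // ltW.
have p0 : 0 <= t ^+ 2 * a ^+ 4 + mu ^+ 2 by rewrite addr_ge0 ?mulr_ge0 ?exprn_ge0 // ltW.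
apply: (@le_trans _ _ (c * t * mu * (t ^+ 2 * a ^+ 4 + mu ^+ 2))); first exact: ler_wpM2r.
have -> : 2 * (c * t * mu) * a ^+ 5 = c * t * mu * (a ^+ 5 + a ^+ 5) by ring.
apply: ler_wpM2l => //; apply: lerD.
  apply: (@le_trans _ _ (1 * a ^+ 4)).
    by apply: ler_wpM2r; [exact: exprn_ge0 (ltW a0) | apply: exprn_ile1 => //; exact: ltW].
  by rewrite mul1r ler_weXn2l.
apply: (@le_trans _ _ (a ^+ 2)); last by rewrite ler_weXn2l.
by apply: lerXn2r => //; rewrite nnegrE ltW.
Qed.

(** Here k ^ - k bounds [coeff] from below, 2 ^ - k bounds the factor 2 ^ - s of the gain, and the
    remaining denominator is the loss in [sparse_family]. *)
Definition flat_const (k Q1 : nat) : R := k%:R ^- k / (2 ^+ k * ((3 * Q1)%:R * 4 ^+ k)).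
Definition err_const (k Q1 : nat) : R := 2 ^+ k * (2 * proc_const R k (k + 3 * Q1)).

Lemma flat_const_gt0 k Q1 : (0 < k)%N -> (0 < Q1)%N -> 0 < flat_const k Q1.
Proof.
by move=> k0 Q0; rewrite divr_gt0 ?invr_gt0 ?mulr_gt0 ?exprn_gt0 ?ltr0n ?muln_gt0.
Qed.

Lemma err_const_gt0 k Q1 : (0 < k)%N -> 0 < err_const k Q1.
Proof.
move=> k0; rewrite !mulr_gt0 ?exprn_gt0 //; apply: addr_gt0; first by rewrite ltr0n !expn_gt0.
by rewrite !mulr_gt0 ?ltr0n // addr_gt0 // /moment_const exprn_gt0.
Qed.

Lemma process_gain (V : finType) (E : {set {set V}}) (k n Q1 D : nat) (mu : R) :
  {in E, forall e : {set V}, #|e| = k} -> (0 < #|E|)%N -> (0 < Q1)%N -> (1 < k)%N ->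
  (n.+2 + level (3 * Q1) (3 * Q1) <= k)%N ->
  #|E|%:R = mu ^+ (3 * Q1) -> 1 <= mu ->
  (forall tau : V -> V, involutive tau -> (\sum_(e in E) #|matched tau e| <= D)%N) ->
  D%:R <= mu ^+ (2 * Q1) ->
  4 * err_const k Q1 <= flat_const k Q1 * 2 ^- k * mu ->
  exists z : V -> R, (forall v, `|z v| <= 1) /\
  \sum_(e in E) \sum_S coeff R n e S * \prod_(v in S) z v <=
   - (flat_const k Q1 * 2 ^- k / 2 * (mu ^+ (2 * Q1) / mu ^+ 3)).
Proof.
move=> Ek E0 Q0 k1 nk Em mu1 matD Dmu hmu.
have mu0 : 0 < mu by lra.
set Q := (3 * Q1)%N in Em nk *.
have Qp : (0 < Q)%N by rewrite /Q; lia.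
have lk : (level Q Q <= k)%N by lia.
have Emu : #|E|%:R <= mu ^+ Q by rewrite Em.
have [p [pQ [T [Tc Ti TE Tm]]]] := sparse_family Ek Qp Qp (ltW mu0) Emu lk.
have [rank [rinj rle]] := degeneracy_order matD.
have [v0 _] : exists v : V, true.
  have [e eE] := card_gt0P E0; have : (0 < #|e|)%N by rewrite (Ek e eE) ltnW.
  by case/card_gt0P => v _; exists v.
have lev_gt0 q : (0 < level Q q)%N by rewrite /level muln_gt0 expn_gt0 Qp.
have T1 : {in T, forall S : {set V}, (1 < #|S|)%N}.
  by move=> S ST; rewrite Tc // /level leq_pmulr // expn_gt0 Qp.
have [des [Td Tdeg]] := designated_vertex v0 rinj rle Ek T1 TE.
have lpk : (level Q p.+1 <= level Q Q)%N by apply: level_mono.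
have sk : (level Q p.+1 <= k)%N by apply: leq_trans lk.
have sl : (Q * level Q p <= level Q p.+1)%N by rewrite /level expnS mulnCA.
set a := mu ^+ Q1; set t : R := 2 ^- k.
have amu : mu <= a by rewrite /a -{1}[mu]expr1 ler_weXn2l.
have a0 : 0 < a by rewrite exprn_gt0.
have t0 : 0 < t by rewrite invr_gt0 exprn_gt0.
have t1 : t <= 1 by rewrite invf_le1 ?exprn_gt0 // exprn_ege1 // ler1n.
(* A vertex is designated for at most 2 ^ k D <= 2 ^ k a ^ 2 sets, so this [th] gives [th] ^ 2
   |[desfam v]| <= 2 ^ - k [mu] ^ - 4 <= [nu] ^ 2. *)
pose th := t / (mu ^+ 2 * a); pose nu := mu ^- 2.
have th0 : 0 < th by rewrite divr_gt0 // mulr_gt0 // exprn_gt0.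
have d1 : 1 <= mu ^+ 2 * a.
  by rewrite -[1]mulr1 ler_pM ?exprn_ege1 // (le_trans mu1).
have th1 : th <= 1 by rewrite ler_pdivrMr ?mul1r ?(le_trans t1) // (lt_le_trans _ d1).
have nu0 : 0 < nu by rewrite invr_gt0 exprn_gt0.
have nu1 : nu <= 1 by rewrite invf_le1 ?exprn_gt0 // exprn_ege1.
have thnu v : th ^+ 2 * #|desfam T des v|%:R <= nu ^+ 2.
  apply: (@le_trans _ _ (th ^+ 2 * (2 ^+ k * a ^+ 2))).
    apply: ler_wpM2l; first by rewrite exprn_ge0 // ltW.
    apply: (@le_trans _ _ (2 ^ k * D)%:R); first by rewrite ler_nat.
    rewrite natrM natrX; apply: ler_wpM2l; first by rewrite exprn_ge0.
    by rewrite /a -exprM mulnC.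
  have -> : th ^+ 2 * (2 ^+ k * a ^+ 2) = t * (t * 2 ^+ k) * nu ^+ 2.
    by rewrite /th /nu; field; rewrite ?gt_eqF // ?exprn_gt0.
  have -> : t * 2 ^+ k = 1 by rewrite /t mulVf // gt_eqF // exprn_gt0.
  by rewrite mulr1 ler_piMl // exprn_ge0 // ltW.
(* The moment index k + 3 Q1 makes the order 2 ^ (k + 3 Q1 + 1) exceed both k and J = Q. *)
have ki : (k <= 2 ^ (k + 3 * Q1).+1)%N.
  apply: leq_trans (ltnW (ltn_expl k (isT : (1 < 2)%N))) _.
  by rewrite leq_exp2l // leqW // leq_addr.
have Ji : (Q < 2 ^ (k + 3 * Q1).+1)%N.
  apply: leq_trans (ltn_expl Q (isT : (1 < 2)%N)) _.
  by rewrite leq_exp2l // leqW // leq_addl.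
have b02 : {in E, forall e S, 0 <= coeff R n e S <= 2}.
  by move=> e _ S; rewrite coeff_ge0 coeff_le2.
have bne : {in E, forall e S, coeff R n e S != 0 -> S \subset e /\ S != set0}.
  by move=> e _ S /coeff_neq0[].
have bT : {in E & T, forall e S : {set V}, S \subset e -> k%:R ^- k <= coeff R n e S}.
  move=> e S eE ST Se; apply: (@le_trans _ _ ((n.+2)%:R ^- k)).
    rewrite lef_pV2 ?posrE ?exprn_gt0 ?ltr0n ?(ltnW k1) //.
    by apply: lerXn2r; rewrite ?nnegrE ?ler0n // ler_nat (leq_trans _ nk) // leq_addr.
  apply: coeff_lower => //; first exact: Ek.
  - by rewrite -card_gt0 Tc.
  - by rewrite Tc // /level oddM.
  - by rewrite Tc // addnC (leq_trans _ nk) // leq_add // leqW.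
have [z [z1 hz]] := process Tc Td Ti sl (lev_gt0 p) (ltW th0) th1 nu0 nu1 thnu sk ki Ji Ek b02 bne bT.
exists z; split=> //; apply: le_trans hz _.
set c := flat_const k Q1; set C := err_const k Q1.
have k0 : (0 < k)%N by apply: ltnW.
have c0 : 0 < c by apply: flat_const_gt0.
have C0 : 0 < C by apply: err_const_gt0.
have Ea : #|E|%:R = a ^+ 3 by rewrite Em /a -exprM mulnC.
have ar := gain_arith mu1 amu t0 t1 c0 (ltW C0) hmu.
have nuJ : nu ^+ Q.+1 = (a ^+ 6 * mu ^+ 2)^-1.
  rewrite /nu -exprVn /a -exprM -exprM -exprD exprVn; congr (_ ^-1 ); congr (_ ^+ _).
  by rewrite /Q; clear; lia.
have -> : #|E|%:R * (2 ^+ k * (2 * (proc_const R k (k + 3 * Q1) * (th ^+ 2 + nu ^+ Q.+1)))) =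
   a ^+ 3 * (C * (th ^+ 2 + (a ^+ 6 * mu ^+ 2)^-1)).
  by rewrite nuJ Ea /C /err_const !mulrA.
have -> : mu ^+ (2 * Q1) = a ^+ 2 by rewrite /a -exprM mulnC.
(* The main term is twice the target, and [gain_arith] lets the error consume one half. *)
have mass : 2 * (c * t / 2 * (a ^+ 2 / mu ^+ 3)) <=
    th / 2 ^+ level Q p.+1 * (k%:R ^- k * \sum_(S in T) #|[set e in E | S \subset e]|%:R).
  apply: (@le_trans _ _ (th / 2 ^+ k * (k%:R ^- k * (#|E|%:R / (Q%:R * 4 ^+ k * mu))))).
    rewrite Ea le_eqVlt; apply/orP; left; apply/eqP.
    rewrite /c /flat_const /th -/Q; field.
    by rewrite !gt_eqF ?exprn_gt0 ?ltr0n.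
  apply: ler_pM.
  - by rewrite divr_ge0 ?exprn_ge0 // ltW.
  - by rewrite !mulr_ge0 ?invr_ge0 ?mulr_ge0 ?exprn_ge0 ?ler0n // ltW.
  - apply: ler_wpM2l; first exact: ltW.
    by rewrite lef_pV2 ?posrE ?exprn_gt0 // ler_weXn2l // ler1n.
  - apply: ler_wpM2l; first by rewrite invr_ge0 exprn_ge0.
    rewrite ler_pdivrMr ?mulr_gt0 ?exprn_gt0 ?ltr0n // mulrC.
    by rewrite -natr_sum.
move: mass; rewrite -/t -lerN2 => mass; apply: le_trans (lerD mass ar) _.
by move: (c * t / 2 * _) => X; lra.
Qed.

End Gain.

(** * Maximal matching, exponents and the final case distinction *)

Lemma max_matching (V : finType) (E : {set {set V}}) : exists2 tau : V -> V, involutive tau &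
  forall sig : V -> V, involutive sig ->
    (\sum_(e in E) #|matched sig e| <= \sum_(e in E) #|matched tau e|)%N.
Proof.
pose W (f : {ffun V -> V}) := (\sum_(e in E) #|matched f e|)%N.
pose inv (f : {ffun V -> V}) := [forall u, f (f u) == u].
have h0 : inv [ffun u => u] by apply/forallP => u; rewrite !ffunE.
case: (arg_maxnP W h0) => f /forallP finv fmax.
exists f => [u|sig sigK]; first exact/eqP.
have -> : (\sum_(e in E) #|matched sig e| = W [ffun u => sig u])%N.
  apply: eq_bigr => e _; congr #|pred_of_set _|; apply/setP => u.
  by rewrite !inE ffunE.
by apply: fmax; apply/forallP => u; rewrite !ffunE sigK.
Qed.

Lemma matched_tperm_gt0 (V : finType) (E : {set {set V}}) e (u v : V) :
  e \in E -> u \in e -> v \in e -> u != v ->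
  (0 < \sum_(e in E) #|matched (tperm u v) e|)%N.
Proof.
move=> eE ue ve uv; rewrite (bigD1 e) //= ltn_addr //.
by apply/card_gt0P; exists u; rewrite inE tpermL ue ve eq_sym.
Qed.

(** The factor [kap] ^ 2 [be] / (2 k) of [matching_gain] with [be] = k ^ - k. *)
Definition pair_const (R : realFieldType) (k : nat) : R :=
  (k%:R ^- k / (4 * 2 ^+ k)) ^+ 2 * k%:R ^- k / (2 * k%:R).

Lemma pair_const_gt0 (R : realFieldType) k : (0 < k)%N -> 0 < pair_const R k.
Proof.
by move=> k0; rewrite !mulr_gt0 ?invr_gt0 ?exprn_gt0 ?mulr_gt0 ?invr_gt0 ?exprn_gt0 ?ltr0n.
Qed.

Lemma coeff_matching_gain (R : realFieldType) (V : finType) (E : {set {set V}}) (k n : nat)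
    (tau : V -> V) :
  {in E, forall e : {set V}, #|e| = k} -> (n.+2 <= k)%N -> involutive tau ->
  exists z : V -> R, (forall v, `|z v| <= 1) /\
  \sum_(e in E) \sum_S coeff R n e S * \prod_(v in S) z v <=
  - (pair_const R k * (\sum_(e in E) #|matched tau e|)%:R).
Proof.
move=> Ek nk tauK; have k0 : (0 < k)%N by apply: leq_trans nk.
have kR : (0 : R) < k%:R ^- k by rewrite invr_gt0 exprn_gt0 // ltr0n.
apply: matching_gain => //.
- by move=> e _ S; rewrite coeff_ge0 coeff_le2.
- by move=> e _ S; apply: coeff_neq0.
- move=> e eE u v ue ve uv; apply: (@le_trans _ _ ((n.+2)%:R ^- k)).
    rewrite lef_pV2 ?posrE ?exprn_gt0 ?ltr0n //.
    by apply: lerXn2r; rewrite ?nnegrE ?ler0n // ler_nat.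
  apply: coeff_lower; rewrite ?cards2 ?uv //; first exact: Ek.
    by rewrite subUset !sub1set ue.
  by rewrite -card_gt0 cards2.
- by rewrite invf_le1 ?exprn_gt0 ?ltr0n // exprn_ege1 // ler1n.
Qed.

(** With [mu] = m ^ (1 / (3 Q1)), the power [mu] ^ (2 Q1) is m ^ (2/3) and the loss [mu] ^ 3 is m ^
    (1 / Q1) <= m ^ [eps]. *)
Lemma powR_exponent (R : realType) (m eps : R) (Q1 : nat) :
  1 <= m -> (0 < Q1)%N -> Q1%:R^-1 <= eps ->
  let mu := m `^ (3 * Q1)%:R^-1 in
  [/\ 1 <= mu, m = mu ^+ (3 * Q1) & m `^ (2 / 3 - eps) <= mu ^+ (2 * Q1) / mu ^+ 3].
Proof.
move=> m1 Q0 heps mu.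
have m0 : 0 < m by apply: lt_le_trans m1.
have QR : (0 : R) < Q1%:R by rewrite ltr0n.
have muE n : mu ^+ n = m `^ (n%:R / (3 * Q1)%:R).
  by rewrite -powR_mulrn ?powR_ge0 // /mu -powRrM mulrC.
have e3 : ((3 * Q1)%:R : R) = 3 * Q1%:R by rewrite natrM.
split.
- by rewrite -[leLHS](powRr0 m) ler_powR // invr_ge0 ler0n.
- by rewrite muE divff ?powRr1 ?ltW // pnatr_eq0 muln_eq0 negb_or /= -lt0n.
- rewrite !muE -powRB ?(gt_eqF m0) ?implybT //; apply: ler_powR => //.
  rewrite e3 natrM.
  have -> : 2 * Q1%:R / (3 * Q1%:R) - 3 / (3 * Q1%:R) = 2 / 3 - Q1%:R^-1 :> R.
    by field; rewrite gt_eqF.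
  lra.
Qed.

Theorem theorem7p7 (R : realType) (eps : R) (heps : 0 < eps) :
  exists q : nat, (0 < q)%N /\
    forall k : nat, exists c : R, 0 < c /\
      forall r : nat, (2 <= r)%N -> (r + q <= k)%N ->
        forall (V : finType) (E : {set {set V}}),
          uniform k E -> (0 < #|E|)%N ->
          exists P : {set {set V}},
            is_cut r P /\
            c * (#|E|%:R `^ (2 / 3 - eps)) <= surplus R k r E P.
Proof.
have [Q1 Q0 hQ] : exists2 Q1 : nat, (0 < Q1)%N & Q1%:R^-1 <= eps.
  exists (Num.truncn eps^-1).+1 => //.
  by rewrite invf_ple ?posrE ?ltr0n //; apply: ltW; apply: truncnS_gt.
(* The number q is the largest set size that can occur, so r + q <= k leaves room for the lower
   bound on [coeff]. *)
set Q := (3 * Q1)%N; exists (level Q Q); split.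
  by rewrite /level muln_gt0 expn_gt0 /Q; case: Q1 Q0 {hQ Q}.
move=> k; have [k1|k1] := leqP k 1.
  by exists 1; split=> // r r2 rk; move: (leq_trans (leq_trans r2 (leq_addr _ _)) rk); rewrite ltnNge k1.
have k0 : (0 < k)%N by apply: ltnW.
pose c1 : R := pair_const R k; pose f1 : R := flat_const R k Q1 * 2 ^- k.
have c10 : 0 < c1 by apply: pair_const_gt0.
have f10 : 0 < f1 by rewrite mulr_gt0 ?flat_const_gt0 // invr_gt0 exprn_gt0.
(* Above this threshold for [mu] the error is absorbed by the gain. *)
pose mu0 : R := Num.max 1 (4 * err_const R k Q1 / f1).
have mu01 : 1 <= mu0 by rewrite le_max lexx.
have mu0p : 0 < mu0 ^+ (2 * Q1) by rewrite exprn_gt0 // (lt_le_trans _ mu01).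
pose c := Num.min (c1 / mu0 ^+ (2 * Q1)) (f1 / 2).
have c0 : 0 < c by rewrite lt_min; apply/andP; split; apply: divr_gt0.
exists c; split=> // -[|[|n]] // _ nk V E uE E0.
have m1 : 1 <= #|E|%:R :> R by rewrite ler1n.
have [] := powR_exponent m1 Q0 hQ; set mu := _ `^ _ => mu1 Em hpow.
set x := #|E|%:R `^ (2 / 3 - eps) in hpow *.
have x0 : 0 < x by rewrite powR_gt0 // (lt_le_trans _ m1).
have mup : 0 < mu by apply: lt_le_trans mu1.
have xle : x <= mu ^+ (2 * Q1).
  apply: le_trans hpow _; rewrite ler_pdivrMr ?exprn_gt0 //.
  by rewrite ler_peMr ?exprn_ege1 // exprn_ge0 // ltW.
suff [z [X [z1 hX zX]]] : exists z : V -> R, exists X, [/\ forall v, `|z v| <= 1, c * x <= X &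
    \sum_(e in E) \sum_S coeff R n e S * \prod_(v in S) z v <= - X].
  have X0 : 0 < X by apply: lt_le_trans hX; rewrite mulr_gt0.
  have [P [cP sP]] := rounding uE z1 X0 zX.
  by exists P; split=> //; apply: le_trans hX sP.
have nk2 : (n.+2 <= k)%N by apply: leq_trans nk; apply: leq_addr.
(* The value D of a best involution has two roles: it is a gain up to a constant, and it bounds all
   matchings in the degeneracy argument. *)
have [tau tauK tauM] := max_matching E.
set D := (\sum_(e in E) #|matched tau e|)%N in tauM.
have c_le1 : c <= c1 / mu0 ^+ (2 * Q1) by rewrite ge_min lexx.
have c_le2 : c <= f1 / 2 by rewrite ge_min lexx orbT.
have c_le3 : c <= c1.
  by apply: le_trans c_le1 _; rewrite ler_pdivrMr // ler_peMr ?exprn_ege1 // ltW.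
have D0 : (0 < D)%N.
  have [e eE] := card_gt0P E0; have e1 : (1 < #|e|)%N by rewrite (uE e eE).
  have [u [v [ue ve uv]]] := card_gt1P e1.
  apply: leq_trans (matched_tperm_gt0 eE ue ve uv) _; apply: tauM.
  exact: tpermK.
have [z [z1 hz]] := coeff_matching_gain R uE nk2 tauK.
have [Dmu|Dmu] := leP (mu ^+ (2 * Q1)) D%:R.
  exists z, (c1 * D%:R); split=> //.
  by apply: ler_pM; rewrite ?(ltW c0) ?(ltW x0) // (le_trans xle).
(* If [mu] <= [mu0], then m is bounded and the gain from D >= 1 suffices. Otherwise D < m ^ (2/3)
   and the random perturbation applies. *)
have [small|large] := leP mu mu0.
  exists z, (c1 * D%:R); split=> //.
  apply: (@le_trans _ _ c1); last by rewrite ler_peMr ?ler1n // ltW.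
  apply: le_trans (ler_wpM2r (ltW x0) c_le1) _.
  rewrite mulrAC ler_pdivrMr //; apply: ler_wpM2l; first exact: ltW.
  by apply: le_trans xle _; apply: lerXn2r; rewrite // nnegrE ltW // (lt_le_trans _ mu01).
have hmu : 4 * err_const R k Q1 <= f1 * mu.
  rewrite [f1 * mu]mulrC -ler_pdivrMr //; apply: le_trans _ (ltW large).
  by rewrite le_max lexx orbT.
have [z' [z'1 hz']] := process_gain uE E0 Q0 k1 nk Em mu1 tauM (ltW Dmu) hmu.
exists z', (f1 / 2 * (mu ^+ (2 * Q1) / mu ^+ 3)); split=> //.
by apply: ler_pM; rewrite ?(ltW c0) ?(ltW x0).
Qed.
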